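(* Let $a<b$ be real, $\Omega=(a,b)$, and $1\le p\le4$. For each $\epsilon>0$ define $F_\epsilon:L^p(\Omega)\to[-\infty,\infty]$ by $$F_\epsilon(u):=\begin{cases}\int_\Omega\epsilon^{-1}(u^2-1)^2+\epsilon^3|u''|^2\,dx,& u\in W^{2,p}(\Omega),\\ +\infty,&\text{otherwise.}\end{cases}$$ Let $(\epsilon_n)$ be positive reals with $\epsilon_n\to0^+$. If $u_n\in L^p(\Omega)$ satisfy $\sup_{n}|F_{\epsilon_n}(u_n)|<\infty$, then there exist a subsequence $(u_{n_k})$ and $u\in BPV(\Omega;\{-1,1\})$ such that $u_{n_k}\to u$ in $L^p(\Omega)$.
   Context: For an interval $I$ and $v:I\to\mathbb{R}$, $\operatorname{Var}_I v:=\sup\{\sum_{i=1}^n|v(x_i)-v(x_{i-1})|: x_0<\dots<x_n\text{ in }I\}$; for $u\in L^1_{loc}(I)$, $\operatorname{essVar}_I u:=\inf\{\operatorname{Var}_I\tilde u:\tilde u\text{ a representative of }u\}$. $BPV(\Omega;\{-1,1\})$ is the set of $u\in L^p(\Omega)$ with $u\in\{-1,1\}$ a.e. and $\operatorname{essVar}_\Omega u<\infty$. *)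

(* Defs.v *)
From HB Require Import structures.
From mathcomp Require Import all_boot all_order all_algebra.
From mathcomp Require Import all_classical all_reals all_analysis.
Set Implicit Arguments. Unset Strict Implicit. Unset Printing Implicit Defensive.
Import Order.TTheory GRing.Theory Num.Theory.
Import numFieldNormedType.Exports.
Local Open Scope classical_set_scope.
Local Open Scope ring_scope.

Section Defs.
Variable R : realType.
Local Notation mu := (@lebesgue_measure R).

Definition Omega (a b : R) : set R := [set x | a < x < b].

Definition in_Lp (a b p : R) (u : R -> R) : Prop :=
  measurable_fun (Omega a b) u /\
  (\int[mu]_(x in Omega a b) ((`|u x| `^ p)%:E) < +oo)%E.

Definition test_fun (a b : R) (phi : R -> R) : Prop :=
  (forall (n : nat) (x : R), derivable (derive1n n phi) x 1) /\
  exists c d : R, a < c /\ c < d /\ d < b /\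
    (forall x : R, (x < c \/ d < x) -> phi x = 0).

Definition W2p_with (a b p : R) (u v w : R -> R) : Prop :=
  in_Lp a b p u /\ in_Lp a b p v /\ in_Lp a b p w /\
  forall phi : R -> R, test_fun a b phi ->
    (\int[mu]_(x in Omega a b) (u x * derive1 phi x)%:E
       = - \int[mu]_(x in Omega a b) (v x * phi x)%:E)%E /\
    (\int[mu]_(x in Omega a b) (v x * derive1 phi x)%:E
       = - \int[mu]_(x in Omega a b) (w x * phi x)%:E)%E.

Definition in_W2p (a b p : R) (u : R -> R) : Prop :=
  exists v w, W2p_with a b p u v w.

(* F_eps(u): the integral (with u'' the weak second derivative, unique a.e.,
   hence the infimum below is just that integral) if u in W^{2,p}, and +oo
   otherwise (infimum of the empty set). *)
Definition F_eps (a b p eps : R) (u : R -> R) : \bar R :=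
  ereal_inf [set I : \bar R | exists v w, W2p_with a b p u v w /\
    I = (\int[mu]_(x in Omega a b)
           ((eps^-1 * (u x ^+ 2 - 1) ^+ 2 + eps ^+ 3 * `|w x| ^+ 2)%:E))%E].

Definition Var (I : set R) (v : R -> R) : \bar R :=
  ereal_sup [set S : \bar R | exists (n : nat) (x : nat -> R),
    (forall i, (i <= n)%N -> I (x i)) /\
    (forall i, (i < n)%N -> x i < x i.+1) /\
    S = (\sum_(i < n) `|v (x i.+1) - v (x i)|)%:E].

Definition essVar (I : set R) (u : R -> R) : \bar R :=
  ereal_inf [set Var I v | v in
    [set v : R -> R | {ae mu, forall x, I x -> v x = u x}]].

Definition BPV_pm1 (a b p : R) (u : R -> R) : Prop :=
  in_Lp a b p u /\
  {ae mu, forall x, Omega a b x -> (u x = 1 \/ u x = -1)} /\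
  (essVar (Omega a b) u < +oo)%E.

End Defs.

(* Main.v *)
Require Import Defs.
From HB Require Import structures.
From mathcomp Require Import all_boot all_order all_algebra.
From mathcomp Require Import all_classical all_reals all_analysis.
From mathcomp Require Import measurable_realfun ring lra.
Import Order.TTheory GRing.Theory Num.Theory.
Import numFieldNormedType.Exports.
Local Open Scope classical_set_scope.
Local Open Scope ring_scope.

(* Testing the weak derivative against smoothed indicators of ]x, y] shows that
   the fundamental theorem of calculus holds between Lebesgue points: u and u'
   behave like C^1 and absolutely continuous functions on a conull set. Cut
   ]a, b[ into cells of length comparable to eps. If two adjacent cells carry
   energy at most an absolute constant eta, then by AM-GM u' oscillates there by
   at most 1/(100 eps), so that u is nearly affine at scale eps; being close to
   1 or -1 at three well-spread points, it cannot change sign. The energy bound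
   leaves boundedly many other pairs, so outside a set of measure O(eps) the sign
   of u_n is a product of boundedly many jump functions x |-> +-1, whose jump
   points converge along a subsequence by Bolzano-Weierstrass. Finally
   (u - v)^4 <= 8 (u^2 - 1)^2 when v = +-1 has the sign of u, and
   t^p <= d + d^-4 t^4 for 1 <= p <= 4 and 0 < d < 1, so the energy controls
   the L^p distance. *)

(** * A smooth transition from 0 to 1 with bounded derivative *)

Section SmoothStep.
Context {R : realType}.
Implicit Types (f g : R -> R) (n m : nat).

(** Carrying each derivative as an explicit function makes closure under sums, products, inverses
    and affine changes of variable a plain induction on [n], with no formula for iterated
    derivatives. *)
Fixpoint n_differentiable n f : Prop :=
  if n is n'.+1 then
    exists2 f', (forall x : R, is_derive x (1 : R) f (f' x)) &
      n_differentiable n' f'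
  else True.

Definition smooth f := forall n, n_differentiable n f.

Lemma n_differentiableW n f : n_differentiable n.+1 f -> n_differentiable n f.
Proof.
elim: n f => [//|n IH] f [f' df Hf']; exists f' => //; exact: IH.
Qed.

Lemma n_differentiable_cst n (c : R) : n_differentiable n (fun=> c).
Proof.
elim: n c => [//|n IH] c; exists (fun=> 0) => // x.
exact: is_derive_cst.
Qed.

Lemma n_differentiableD n f g : n_differentiable n f -> n_differentiable n g ->
  n_differentiable n (fun x => f x + g x).
Proof.
elim: n f g => [//|n IH] f g [f' df Hf] [g' dg Hg].
exists (fun x => f' x + g' x); last exact: IH.
by move=> x; apply: is_deriveD.
Qed.

Lemma n_differentiableM n f g : n_differentiable n f -> n_differentiable n g ->
  n_differentiable n (fun x => f x * g x).
Proof.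
elim: n f g => [//|n IH] f g Hf Hg.
have [f' df Hf'] := Hf; have [g' dg Hg'] := Hg.
exists (fun x => f x * g' x + g x * f' x).
  by move=> x; apply: is_deriveM.
by apply: n_differentiableD; apply: IH => //; exact: n_differentiableW.
Qed.

Lemma n_differentiableV n f : (forall x, f x != 0) -> n_differentiable n f ->
  n_differentiable n (fun x => (f x)^-1).
Proof.
move=> f0; elim: n => [//|n IH] Hf.
have [f' df Hf'] := Hf.
exists (fun x => (-1 * ((f x)^-1 * (f x)^-1)) * f' x).
  move=> x; apply: (is_derive_eq (is_deriveV (f0 x) (df x))).
  by rewrite /= mulN1r expr2 invfM.
have Hi := IH (n_differentiableW _ _ Hf).
apply: n_differentiableM => //; apply: n_differentiableM.
  exact: n_differentiable_cst.
exact: n_differentiableM.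
Qed.

Lemma is_derive_affine (c d x : R) : is_derive x (1 : R) (fun t => c * t + d) c.
Proof.
apply: (is_derive_eq (@is_deriveD _ _ _ (c \*: (@id R)) (cst d) x 1 (c *: 1) 0
  (is_deriveZ _ (is_derive_id _ _)) (is_derive_cst _ _ _))).
by rewrite addr0 [_ *: _]mulr1.
Qed.

Lemma n_differentiable_affine n f (c d : R) : n_differentiable n f ->
  n_differentiable n (fun x => f (c * x + d)).
Proof.
elim: n f => [//|n IH] f [f' df Hf'].
exists (fun x => c * f' (c * x + d)); last first.
  apply: n_differentiableM; [exact: n_differentiable_cst|exact: IH].
move=> x.
have := @is_derive1_comp _ f (fun t => c * t + d) x _ _ (df _) (is_derive_affine c d x).
by rewrite mulrC.
Qed.

Lemma smooth_derivable f n x : smooth f -> derivable (derive1n n f) x 1.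
Proof.
move=> /(_ n.+1); elim: n f => [|n IH] f [f' df Hf'].
  by case: (df x).
rewrite derive1Sn; suff -> : f^`()%classic = f' by exact: IH.
by apply/funext => y; rewrite derive1E; have dfy := df y; rewrite derive_val.
Qed.

(* The family [flat m] is closed under differentiation:
   [(flat m)' = flat m.+2 - m * flat m.+1]. *)
Definition flat m (t : R) : R := if 0 < t then t^-1 ^+ m * expR (- t^-1) else 0.

Lemma flat_ge0 m t : 0 <= flat m t.
Proof.
rewrite /flat; case: ifPn => // t0.
by rewrite mulr_ge0 ?expR_ge0// exprn_ge0// invr_ge0 ltW.
Qed.

Lemma flat_gt0 m t : 0 < t -> 0 < flat m t.
Proof. by move=> t0; rewrite /flat t0 mulr_gt0 ?expR_gt0 ?exprn_gt0 ?invr_gt0. Qed.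

Lemma flat_eq0 m t : t <= 0 -> flat m t = 0.
Proof. by move=> t0; rewrite /flat ltNge t0. Qed.

(** The exponential beats powers: with [y = t^-1] and [q = m.+2], raising
    [expR (y / q) >= 1 + y / q >= y / q] to the power [q] bounds [expR y] from below. The two extra
    powers of [t] yield the derivative at 0. *)
Lemma flat_le m t : 0 < t -> flat m t <= (m.+2)%:R ^+ m.+2 * t ^+ 2.
Proof.
move=> t0; rewrite /flat t0 expRN.
have mm0 : 0 < m.+2%:R :> R by [].
have mm1 : m.+2%:R != 0 :> R by rewrite gt_eqF.
have y0 : 0 < t^-1 by rewrite invr_gt0.
have H : (t^-1 / m.+2%:R) ^+ m.+2 <= expR (t^-1).
  rewrite -[X in expR X](@divfK _ m.+2%:R)// expRM_natr lerXn2r// ?nnegrE.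
  - by rewrite divr_ge0// ltW.
  - exact: expR_ge0.
  - by rewrite (le_trans _ (expR_ge1Dx _))// lerDr.
rewrite ler_pdivrMr ?expR_gt0//.
have -> : t^-1 ^+ m = (m.+2%:R ^+ m.+2 * t ^+ 2) * (t^-1 / m.+2%:R) ^+ m.+2.
  have tK : t * t^-1 = 1 by rewrite divff// gt_eqF.
  rewrite mulrC mulrA -exprMn divfK// -[m.+2]addn2 exprD -mulrA -exprMn.
  by rewrite [t^-1 * t]mulrC tK expr1n mulr1.
by rewrite ler_wpM2l// mulr_ge0 ?exprn_ge0// ltW.
Qed.

Lemma flat_derive m x :
  is_derive x (1 : R) (flat m) (flat m.+2 x + - m%:R * flat m.+1 x).
Proof.
have [x0|x0|->] := ltgtP x 0.
- apply: (@near_eq_is_derive _ _ _ (cst 0)).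
  + near=> y; rewrite /flat ifF//; apply/negbTE; rewrite -leNgt ltW//.
    by near: y; exact: lt_nbhsl.
  + by rewrite !flat_eq0 ?ltW// mulr0 addr0; exact: is_derive_cst.
- apply: (@near_eq_is_derive _ _ _ (fun y : R => y^-1 ^+ m * expR (- y^-1))).
    by near=> y; rewrite /flat ifT//; near: y; exact: lt_nbhsr.
  have x1 : x != 0 by rewrite gt_eqF.
  have dV : is_derive x (1 : R) (fun y : R => y^-1) (- x ^- 2).
    apply: (is_derive_eq (is_deriveV (f := id) x1 (is_derive_id _ _))).
    by rewrite [_ *: _]mulr1.
  have dE : is_derive x (1 : R) (fun y : R => expR (- y^-1)) (expR (- x^-1) * x ^- 2).
    apply: (is_derive_eq (@is_derive1_comp _ expR (fun y => - y^-1) x _ _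
      (is_derive_expR _) (is_deriveN dV))).
    by rewrite opprK.
  have dX := @is_deriveX _ _ (fun y : R => y^-1) m x 1 _ dV.
  have dXE : is_derive x (1 : R) (fun y : R => y^-1 ^+ m) (m%:R * x^-1 ^+ m.-1 * (- x ^- 2)).
    by have <- : (fun y : R => y^-1) ^+ m = (fun y : R => y^-1 ^+ m)
      by apply/funext => y; rewrite fctE.
  apply: (is_derive_eq (@is_deriveM _ _ _ _ x 1 _ _ dXE dE)).
  rewrite /flat x0 /= /GRing.scale/= -!exprVn.
  by case: m {dX dXE} => [|m] /=; rewrite ?expr0 -?natr1 ?exprS; ring.
(* At the origin the difference quotient lies between 0 and [C * |h|], by the quadratic bound
   [flat_le]. *)
- have H : h^-1 *: (flat m (h *: 1 + 0) - flat m 0) @[h --> (0:R)^'] --> (0:R).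
    pose C : R := m.+2%:R ^+ m.+2.
    apply: (@squeeze_cvgr _ _ _ _ (fun=> 0) (fun h => C * `|h|)).
    - near=> h.
      rewrite (@flat_eq0 m 0)// subr0 addr0 /GRing.scale/= mulr1.
      have [h0|h0] := leP h 0.
        by rewrite flat_eq0// mulr0 lexx mulr_ge0 ?exprn_ge0.
      rewrite mulr_ge0 ?invr_ge0 ?flat_ge0 ?(ltW h0)//= gtr0_norm//.
      rewrite mulrC ler_pdivrMr// -mulrA -expr2; exact: flat_le.
    - exact: cvg_cst.
    - rewrite -[X in _ --> X](mulr0 C); apply: cvgM; first exact: cvg_cst.
      rewrite -[X in _ --> X](@normr0 _ R); apply: cvg_norm.
      exact: cvg_within.
  apply: DeriveDef; first exact: cvgP H.
  by rewrite !flat_eq0// mulr0 addr0; exact: cvg_lim H.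
Unshelve. all: by end_near. Qed.

Lemma n_differentiable_flat n m : n_differentiable n (flat m).
Proof.
elim: n m => [//|n IH] m.
exists (fun x => flat m.+2 x + - m%:R * flat m.+1 x); first exact: flat_derive.
by apply: n_differentiableD => //; apply: n_differentiableM => //;
  exact: n_differentiable_cst.
Qed.

(** The usual quotient of [flat 0]; [1 - t] is written [-1 * t + 1] to match
    [n_differentiable_affine]. *)
Definition smooth_step (t : R) : R :=
  flat 0 t * (flat 0 t + flat 0 (-1 * t + 1))^-1.

Let den_gt0 t : 0 < flat 0 t + flat 0 (-1 * t + 1).
Proof.
have [t0|t0] := ltP 0 t.
  by rewrite ltr_pwDl ?flat_gt0 ?flat_ge0.
by rewrite ltr_wpDl ?flat_ge0// flat_gt0//; lra.
Qed.

Lemma smooth_smooth_step : smooth smooth_step.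
Proof.
move=> n; apply: n_differentiableM; first exact: n_differentiable_flat.
apply: n_differentiableV => [x|]; first by rewrite gt_eqF.
apply: n_differentiableD; first exact: n_differentiable_flat.
exact/n_differentiable_affine/n_differentiable_flat.
Qed.

Lemma smooth_step_ge0 t : 0 <= smooth_step t.
Proof. by rewrite mulr_ge0 ?invr_ge0 ?flat_ge0// ltW. Qed.

Lemma smooth_step_le1 t : smooth_step t <= 1.
Proof. by rewrite ler_pdivrMr// mul1r lerDl flat_ge0. Qed.

Lemma smooth_step_eq0 t : t <= 0 -> smooth_step t = 0.
Proof. by move=> t0; rewrite /smooth_step flat_eq0// mul0r. Qed.

Lemma smooth_step_eq1 t : 1 <= t -> smooth_step t = 1.
Proof.
move=> t1; rewrite /smooth_step (@flat_eq0 _ (-1 * t + 1)) ?addr0; last by lra.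
by rewrite divff// gt_eqF// flat_gt0//; lra.
Qed.

(** The derivative is itself differentiable, hence continuous; it vanishes where the step is locally
    constant, and the extreme value theorem on [0, 1] bounds it everywhere. *)
Lemma smooth_step_derive : exists k : R -> R, [/\
  (forall x, is_derive x (1 : R) smooth_step (k x)), continuous k,
  (forall x, x < 0 \/ 1 < x -> k x = 0) &
  exists2 C, 0 < C & forall x, `|k x| <= C].
Proof.
have [k dk [k' dk' _]] := smooth_smooth_step 2.
have ck : continuous k.
  move=> x; apply/differentiable_continuous/derivable1_diffP.
  by case: (dk' x).
have k0 x : x < 0 \/ 1 < x -> k x = 0.
  have kE y : k y = smooth_step^`()%classic y.
    by rewrite derive1E; have := dk y => ?; rewrite derive_val.
  case=> [x0|x1]; rewrite kE derive1E.
    rewrite (@near_eq_derive _ _ _ _ (cst 0)) ?derive_cst//.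
    near=> z; rewrite smooth_step_eq0// ltW//.
    by near: z; exact: lt_nbhsl.
  rewrite (@near_eq_derive _ _ _ _ (cst (1 : R))) ?derive_cst//.
  near=> z; rewrite smooth_step_eq1// ltW//.
  by near: z; exact: lt_nbhsr.
exists k; split; [exact: dk|exact: ck|exact: k0|].
have [c _ Hc] := @EVT_max R (fun x => `|k x|) 0 1 ler01
  (continuous_subspaceT (fun x => continuous_comp (ck x) (@norm_continuous _ _ _))).
exists (`|k c| + 1) => [|x]; first by rewrite ltr_wpDl.
have [x0|x0] := ltP x 0; first by rewrite k0 ?normr0; [rewrite addr_ge0|left].
have [x1|x1] := ltP 1 x; first by rewrite k0 ?normr0; [rewrite addr_ge0|right].
by rewrite ler_wpDr// Hc// in_itv/= x0.
Unshelve. all: by end_near. Qed.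

End SmoothStep.

(** * Smoothed indicators as test functions *)

Section StepTestFunction.
Context {R : realType}.
Local Notation mu := (@lebesgue_measure R).
Implicit Types (f g : R -> R).

Lemma measurable_Omega (a b : R) : measurable (Omega a b).
Proof.
rewrite (_ : Omega a b = [set` `]a, b[]); first exact: measurable_itv.
by apply/seteqP; split => x /=; rewrite in_itv.
Qed.

Lemma lebesgue_measure_Omega (a b : R) : a < b ->
  mu (Omega a b) = (b - a)%:E.
Proof.
move=> ab; rewrite (_ : Omega a b = [set` `]a, b[]).
  by rewrite lebesgue_measure_itv/= lte_fin ab.
by apply/seteqP; split => x /=; rewrite in_itv.
Qed.

Lemma cvgr_at_right (u : nat -> R) : (forall n, 0 < u n) -> u @ \oo --> 0 ->
  u @ \oo --> 0^'+.
Proof.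
move=> u0 ucvg A A0; have [N _ HN] := ucvg _ A0.
by exists N => // n Nn; exact: HN _ Nn (u0 n).
Qed.

(** The difference of two steps rises on [x, x + d] and falls on [y, y + d], so its support is
    compact in the open interval. Its derivative is a difference of two averaging kernels, one at
    each endpoint. *)
Lemma test_fun_step (k : R -> R) (a b x y d : R) :
  (forall x, is_derive x (1 : R) smooth_step (k x)) ->
  a < x -> x < y -> 0 < d -> y + d < b ->
  let phi t := smooth_step ((t - x) / d) - smooth_step ((t - y) / d) in
  test_fun a b phi /\
  derive1 phi = (fun t => d^-1 * k ((t - x) / d) - d^-1 * k ((t - y) / d)).
Proof.
move=> dk ax xy d0 ydb phi.
have E z : (fun t => (t - z) / d) = (fun t => d^-1 * t + (- z / d)).
  by apply/funext => t; rewrite mulrBl mulNr mulrC.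
have dS z t : is_derive t (1 : R) (fun t => smooth_step ((t - z) / d))
    (d^-1 * k ((t - z) / d)).
  have H : is_derive t (1 : R) (fun t => (t - z) / d) d^-1.
    by rewrite E; exact: is_derive_affine.
  have := @is_derive1_comp _ smooth_step (fun t => (t - z) / d) t _ _ (dk _) H.
  by rewrite mulrC.
split; last first.
  apply/funext => t; rewrite derive1E.
  by have H := is_deriveB (dS x t) (dS y t); rewrite derive_val.
have sS z : smooth (fun t => smooth_step ((t - z) / d)).
  move=> n; have := n_differentiable_affine n smooth_step d^-1 (- z / d) (smooth_smooth_step n).
  by congr n_differentiable; apply/funext => t; rewrite mulrBl mulNr mulrC.
split.
  move=> n t; apply: smooth_derivable => m.
  rewrite (_ : phi = fun t => smooth_step ((t - x) / d) +
      -1 * smooth_step ((t - y) / d)); last first.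
    by apply/funext => s; rewrite mulN1r.
  apply: n_differentiableD; first exact: sS.
  by apply: n_differentiableM; [exact: n_differentiable_cst|exact: sS].
exists x, (y + d); split => //; split; first by lra.
split => // t [tx|tyd]; rewrite /phi.
  by rewrite !smooth_step_eq0 ?subrr// pmulr_lle0 ?invr_gt0//; lra.
by rewrite !smooth_step_eq1 ?subrr// ler_pdivlMr//; lra.
Qed.

Lemma integral_step_kernel (k : R -> R) (a b x d : R) :
  (forall x, is_derive x (1 : R) smooth_step (k x)) -> continuous k ->
  (forall x, x < 0 \/ 1 < x -> k x = 0) ->
  a < x -> 0 < d -> x + d < b ->
  (\int[mu]_(t in Omega a b) (d^-1 * k ((t - x) / d))%:E = 1)%E.
Proof.
move=> dk ck k0 ax d0 xdb.
have ck' : continuous (fun t => d^-1 * k ((t - x) / d)).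
  move=> t; apply: cvgM; first exact: cvg_cst.
  apply: (@continuous_comp _ _ _ (fun t => (t - x) / d) k); last exact: ck.
  apply: cvgM; last exact: cvg_cst.
  by apply: cvgB; [exact: cvg_id|exact: cvg_cst].
transitivity (\int[mu]_(t in `[x, (x + d)%R]) (d^-1 * k ((t - x) / d))%:E)%E.
  rewrite [LHS]integral_mkcond [RHS]integral_mkcond; apply: eq_integral => t _.
  rewrite !patchE; have [tx|/negP tx] := boolP (x <= t <= x + d).
    by rewrite !mem_set//=; apply/andP; split; lra.
  rewrite (memNset (A := [set` `[x, x + d]])) /= ?in_itv//.
  case: ifPn => // _; rewrite k0 ?mulr0//.
  move/negP: tx; rewrite negb_and -!ltNge => /orP[tx|tx].
    by left; rewrite pmulr_llt0 ?invr_gt0//; lra.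
  by right; rewrite ltr_pdivlMr//; lra.
have xxd : x < x + d by lra.
have dS t : is_derive t (1 : R) (fun t => smooth_step ((t - x) / d))
    (d^-1 * k ((t - x) / d)).
  have H : is_derive t (1 : R) (fun t => (t - x) / d) d^-1.
    rewrite (_ : (fun t => (t - x) / d) = (fun t => d^-1 * t + (- x / d))).
      exact: is_derive_affine.
    by apply/funext => s; rewrite mulrBl mulNr mulrC.
  have := @is_derive1_comp _ smooth_step (fun t => (t - x) / d) t _ _ (dk _) H.
  by rewrite mulrC.
have cS : continuous (fun t => smooth_step ((t - x) / d)).
  move=> t; apply/differentiable_continuous/derivable1_diffP; by case: (dS t).
rewrite (@continuous_FTC2 _ _ (fun t => smooth_step ((t - x) / d))) //.
- rewrite addrAC subrr add0r divff ?gt_eqF// mul0r smooth_step_eq1// smooth_step_eq0//.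
  by rewrite sube0.
- exact: continuous_subspaceT.
- split.
  + by move=> t _; case: (dS t).
  + by apply: cvg_at_right_filter; exact: cS.
  + by apply: cvg_at_left_filter; exact: cS.
- by move=> t _; rewrite derive1E; have H := dS t; rewrite derive_val.
Qed.

End StepTestFunction.

(** * Kernel averages at Lebesgue points *)

Section KernelAverage.
Context {R : realType}.
Local Notation mu := (@lebesgue_measure R).
Implicit Types (f g K : R -> R).

Lemma integrable_mul_bounded (D : set R) f K (C : R) : measurable D ->
  mu.-integrable D (EFin \o f) -> measurable_fun D K ->
  (forall x, D x -> `|K x| <= C) ->
  mu.-integrable D (EFin \o (fun t => f t * K t)).
Proof.
move=> mD fi mK KC.
rewrite (_ : EFin \o _ = (EFin \o f) \* (EFin \o K))%E; last exact/funext.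
apply: integrableMl => //; exists C; split; first exact: num_real.
by move=> y Cy x Dx /=; rewrite (le_trans (KC _ Dx))// ltW.
Qed.

(** The kernel has mass 1, so the error is the integral of [f t - f x] against it. The kernel is
    bounded by [C / d] and lives in the ball of radius [2 * d], of measure [4 * d]: this is [4 * C]
    times the mean deviation, which tends to 0 with [d] at a Lebesgue point. *)
Lemma kernel_lebesgue_pt (k : R -> R) (C : R) f (a b x d : R) :
  (forall x, is_derive x (1 : R) smooth_step (k x)) -> continuous k ->
  (forall x, x < 0 \/ 1 < x -> k x = 0) ->
  (forall x, `|k x| <= C) ->
  0 < d -> a < x - 2 * d -> x + 2 * d < b ->
  mu.-integrable (Omega a b) (EFin \o f) ->
  (`| \int[mu]_(t in Omega a b) (f t * (d^-1 * k ((t - x) / d)))%:E - (f x)%:E |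
    <= (4 * C)%:E * davg (f \_ (Omega a b)) x (2 * d))%E.
Proof.
move=> dk ck k0 kC d0 axd xdb fi.
have C0 : 0 <= C by rewrite (le_trans _ (kC 0)).
have mO := measurable_Omega a b.
have ab : a < b by lra.
pose K t := d^-1 * k ((t - x) / d).
have cK : continuous K.
  move=> t; apply: cvgM; first exact: cvg_cst.
  apply: (@continuous_comp _ _ _ (fun t => (t - x) / d) k); last exact: ck.
  apply: cvgM; last exact: cvg_cst.
  by apply: cvgB; [exact: cvg_id|exact: cvg_cst].
have mK (D : set R) : measurable_fun D K.
  by apply: measurable_funTS; exact: continuous_measurable_fun.
have KC t : `|K t| <= d^-1 * C.
  by rewrite normrM gtr0_norm ?invr_gt0// ler_wpM2l// invr_ge0 ltW.
have ci : mu.-integrable (Omega a b) (EFin \o (fun=> f x)).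
  apply: measurable_bounded_integrable => //.
    by rewrite [ltLHS](lebesgue_measure_Omega a b ab) ltry.
  exists `|f x|; split; first exact: num_real.
  by move=> y fy z _ /=; rewrite ltW.
have fKi := @integrable_mul_bounded _ f K _ mO fi (mK _) (fun t _ => KC t).
have cKi := @integrable_mul_bounded _ _ K _ mO ci (mK _) (fun t _ => KC t).
have Ki : mu.-integrable (Omega a b) (EFin \o K).
  apply: measurable_bounded_integrable => //.
    by rewrite [ltLHS](lebesgue_measure_Omega a b ab) ltry.
    exact: mK.
  exists (d^-1 * C); split; first exact: num_real.
  by move=> y fy z _ /=; rewrite (le_trans (KC z))// ltW.
have K1 : (\int[mu]_(t in Omega a b) (f x * K t)%:E = (f x)%:E)%E.
  under eq_integral do rewrite EFinM.
  rewrite integralZl// (@integral_step_kernel _ k)// ?mule1//; lra.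
have bO : ball x (2 * d) `<=` Omega a b.
  by move=> t; rewrite ball_itv/= in_itv/= /Omega/= => tb; apply/andP; split; lra.
have mB : measurable (ball x (2 * d)) by exact: measurable_ball.
have mfB : measurable_fun (ball x (2 * d)) f.
  by apply: measurable_funS bO _ => //; apply/measurable_EFinP; exact: measurable_int fi.
rewrite -{1}K1 -integralB_EFin//=.
apply: le_trans (le_abse_integral _ _ _) _ => //.
  apply/measurable_EFinP; apply: measurable_funB; apply/measurable_EFinP.
    exact: measurable_int fKi.
  exact: measurable_int cKi.
have -> : (\int[mu]_(t in Omega a b) `|(f t * K t)%:E - (f x * K t)%:E| =
    \int[mu]_(t in ball x (2 * d)) `|(f t * K t)%:E - (f x * K t)%:E|)%E.
  rewrite [LHS]integral_mkcond [RHS]integral_mkcond; apply: eq_integral => t _.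
  rewrite !patchE; have [tx|tx] := pselect (ball x (2 * d) t).
    by rewrite !mem_set//; exact: bO.
  rewrite (memNset tx); case: ifPn => // _.
  move: tx; rewrite ball_itv/= in_itv/= => /negP; rewrite negb_and -!leNgt => tx.
  have kt : k ((t - x) / d) = 0.
    apply: k0; case/orP : tx => tx.
      by left; rewrite pmulr_llt0 ?invr_gt0//; lra.
    by right; rewrite ltr_pdivlMr//; lra.
  by rewrite /K kt !mulr0 subrr normr0.
rewrite /davg /iavg lebesgue_measure_ball; last by lra.
have d20 : (2 * d *+ 2) != 0 by rewrite -mulr_natr !mulf_neq0 ?gt_eqF.
have -> : ((2 * d *+ 2)%:E^-1)%E = ((2 * d *+ 2)^-1)%:E by rewrite inver (negbTE d20).
have Fx : (f \_ (Omega a b)) x = f x.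
  by rewrite patchE mem_set//=; apply/andP; split; lra.
rewrite Fx muleA -EFinM.
have -> : (\int[mu]_(y in ball x (2 * d)) `|((center (f x) \o f \_ (Omega a b)) y)%:E| =
   \int[mu]_(y in ball x (2 * d)) (`|f y - f x|)%:E)%E.
  by apply: eq_integral => t; rewrite inE => tb; rewrite /= patchE mem_set//; exact: bO.
rewrite -ge0_integralZl_EFin//; last 2 first.
- by apply/measurable_EFinP; apply: measurableT_comp => //; exact: measurable_funB.
- by rewrite mulr_ge0 ?mulr_ge0// invr_ge0 -mulr_natr; lra.
apply: ge0_le_integral => //.
- apply/measurable_EFinP; apply: measurableT_comp => //.
  by apply: measurable_funB; apply: measurable_funM => //; exact: mK.
- apply/measurable_EFinP; apply: measurable_funM => //.
  by apply: measurableT_comp => //; exact: measurable_funB.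
- move=> t _; rewrite -EFinM lee_fin -mulrBl normrM mulrC ler_wpM2r//.
  rewrite (le_trans (KC t))// le_eqVlt; apply/orP; left; apply/eqP.
  by rewrite -mulr_natr; field; rewrite gt_eqF.
Qed.

End KernelAverage.

(** * The fundamental theorem of calculus for weak derivatives *)

Section WeakDerivativeFTC.
Context {R : realType}.
Local Notation mu := (@lebesgue_measure R).
Implicit Types (f g K : R -> R).

(** Each sequence is eventually constant. At [t = x] the value is 0, so a difference of two such
    limits is the indicator of a half-open interval []x, y]]. *)
Lemma cvg_smooth_step (d : nat -> R) (x t : R) : (forall n, 0 < d n) ->
  d @ \oo --> 0 ->
  (fun n => smooth_step ((t - x) / d n)) @ \oo --> (if x < t then 1 else 0 : R).
Proof.
move=> d0 dcvg; case: ifPn => [xt|]; last first.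
  rewrite -leNgt => tx; apply: cvg_near_cst; apply: nearW => n.
  by apply: smooth_step_eq0; rewrite pmulr_lle0 ?invr_gt0// subr_le0.
apply: cvg_near_cst; near=> n.
apply: smooth_step_eq1; rewrite ler_pdivlMr// mul1r ltW//.
near: n; apply: (cvgr_lt 0) => //.
by rewrite subr_gt0.
Unshelve. all: by end_near. Qed.

(** Test with the smoothed indicators of []x, y]] and let the width tend to 0. The side with [f] is
    a difference of kernel averages converging to [f x - f y]; the side with [g] converges by
    domination by [|g|]. *)
Lemma weak_derivative_lebesgue_pt (a b : R) f g :
  mu.-integrable (Omega a b) (EFin \o f) ->
  mu.-integrable (Omega a b) (EFin \o g) ->
  (forall phi : R -> R, test_fun a b phi ->
    (\int[mu]_(x in Omega a b) (f x * derive1 phi x)%:E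
       = - \int[mu]_(x in Omega a b) (g x * phi x)%:E)%E) ->
  forall x y, a < x -> x < y -> y < b ->
    lebesgue_pt (f \_ (Omega a b)) x -> lebesgue_pt (f \_ (Omega a b)) y ->
  f y - f x = \int[mu]_(t in `]x, y]) g t.
Proof.
move=> fi gi fg x y ax xy yb fx fy.
have mO := measurable_Omega a b.
have [k [dk ck k0 [C C0 kC]]] := @smooth_step_derive R.
(* With a third of the distance to the boundary, the balls of radius [2 * d n] around [x] and [y]
   stay inside the interval. *)
pose d0 := Num.min (x - a) (b - y) / 3.
have d00 : 0 < d0 by rewrite divr_gt0// lt_min !subr_gt0 ax.
have d0a : 3 * d0 <= x - a.
  by rewrite /d0 mulrC divfK// ge_min lexx.
have d0b : 3 * d0 <= b - y.
  by rewrite /d0 mulrC divfK// ge_min lexx orbT.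
pose d (n : nat) := d0 / n.+1%:R.
have dgt0 n : 0 < d n by rewrite divr_gt0.
have dle n : d n <= d0 by rewrite ler_pdivrMr// ler_peMr// ?ler1n// ltW.
have dcvg : d @ \oo --> 0.
  rewrite -[X in _ --> X](mulr0 d0); apply: cvgM; first exact: cvg_cst.
  exact: cvg_harmonic.
pose A z n := (\int[mu]_(t in Omega a b) (f t * ((d n)^-1 * k ((t - z) / d n)))%:E)%E.
have Acvg z : x <= z <= y -> lebesgue_pt (f \_ (Omega a b)) z ->
    A z @ \oo --> (f z)%:E.
  move=> xzy fz.
  have Dcvg : (fun n => (4 * C)%:E * davg (f \_ (Omega a b)) z (2 * d n)%R)%E @ \oo --> 0%E.
    rewrite -[X in _ --> X](mule0 (4 * C)%R%:E); apply: cvgeZl => //.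
    have d2cvg : (fun n => 2 * d n) @ \oo --> 0^'+.
      apply: cvgr_at_right => [n|]; first by rewrite mulr_gt0.
      by rewrite -[X in _ --> X](mulr0 2); apply: cvgM => //; exact: cvg_cst.
    exact: cvg_comp d2cvg fz.
  apply/sube_cvg0 => //; apply/cvg_abse0P.
  apply: (squeeze_cvge _ (cvg_cst _) Dcvg); apply: nearW => n.
  rewrite abse_ge0/=; apply: kernel_lebesgue_pt => //; have := dle n; lra.
pose phi n t := smooth_step ((t - x) / d n) - smooth_step ((t - y) / d n).
have ydb n : y + d n < b by have := dle n; lra.
have phi_test n := @test_fun_step R k a b x y (d n) dk ax xy (dgt0 n) (ydb n).
have cK (z : R) n : continuous (fun t : R => (d n)^-1 * k ((t - z) / d n)).
  move=> t; apply: cvgM; first exact: cvg_cst.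
  apply: (@continuous_comp _ _ _ (fun t => (t - z) / d n) k); last exact: ck.
  apply: cvgM; last exact: cvg_cst.
  by apply: cvgB; [exact: cvg_id|exact: cvg_cst].
have fKi (z : R) n : mu.-integrable (Omega a b)
    (EFin \o (fun t => f t * ((d n)^-1 * k ((t - z) / d n)))).
  apply: (@integrable_mul_bounded _ _ _ _ ((d n)^-1 * C)) => //.
    by apply: measurable_funTS; apply: continuous_measurable_fun; exact: cK.
  by move=> t _; rewrite normrM gtr0_norm ?invr_gt0// ler_wpM2l// invr_ge0 ltW.
have AE n : (A x n - A y n = - \int[mu]_(t in Omega a b) (g t * phi n t)%:E)%E.
  have [tp dp] := phi_test n.
  rewrite -fg// dp /A -integralB_EFin//.
  by apply: eq_integral => t _; rewrite -EFinB -mulrBr.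
have Bcvg : (fun n => \int[mu]_(t in Omega a b) (g t * phi n t)%:E)%E @ \oo -->
   (\int[mu]_(t in Omega a b) (g t * \1_(`]x, y]) t)%:E)%E.
  have mphi n : measurable_fun setT (phi n).
    apply: continuous_measurable_fun => t.
    apply/differentiable_continuous/derivable1_diffP.
    by have [[+ _] _] := phi_test n => /(_ 0%N t).
  have mg : measurable_fun (Omega a b) g.
    by apply/measurable_EFinP; exact: measurable_int gi.
  have [] := @dominated_convergence _ _ _ mu _ mO
    (fun n t => (g t * phi n t)%:E) (fun t => (g t * \1_(`]x, y]) t)%:E) (fun t => `|(g t)%:E|%E) => //.
  - move=> n; apply/measurable_EFinP; apply: measurable_funM => //.
    by apply: measurable_funTS; exact: mphi.
  - by apply/measurable_EFinP; apply: measurable_funM.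
  - apply: aeW => t _; apply: cvg_EFin.
      exact: nearW.
    apply: cvgM; first exact: cvg_cst.
    rewrite indicE; have -> : ((t \in [set` `]x, y]])%:R : R) =
        (if x < t then 1 else 0) - (if y < t then 1 else 0).
      rewrite mem_setE in_itv/=; case: (ltP x t) => xt; case: (ltP y t) => yt //=; lra.
    by apply: cvgB; exact: cvg_smooth_step.
  - exact: integrable_abse.
  - apply: aeW => t n _; rewrite EFinM abseM -[leRHS]mule1 lee_pmul//= lee_fin.
    have := @smooth_step_ge0 R ((t - x) / d n).
    have := @smooth_step_ge0 R ((t - y) / d n).
    have := @smooth_step_le1 R ((t - x) / d n).
    have := @smooth_step_le1 R ((t - y) / d n).
    by rewrite ler_norml /phi; lra.
have E : ((f x)%:E - (f y)%:E = - \int[mu]_(t in Omega a b) (g t * \1_(`]x, y]) t)%:E)%E.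
  have H1 : (fun n => A x n - A y n)%E @ \oo --> ((f x)%:E - (f y)%:E)%E.
    by apply: cvgeB => //; apply: Acvg => //; rewrite lexx ltW.
  have H2 : (fun n => A x n - A y n)%E @ \oo -->
      (- \int[mu]_(t in Omega a b) (g t * \1_(`]x, y]) t)%:E)%E.
    by under eq_fun do rewrite AE; exact: cvgeN.
  by rewrite -(cvg_lim _ H1)// -(cvg_lim _ H2).
have E2 : (\int[mu]_(t in Omega a b) (g t * \1_(`]x, y]) t)%:E = \int[mu]_(t in `]x, y]) (g t)%:E)%E.
  rewrite [LHS]integral_mkcond [RHS]integral_mkcond; apply: eq_integral => t _.
  rewrite !patchE indicE; have [txy|txy] := pselect (`]x, y]%classic t).
    rewrite !mem_set//= ?mulr1//; move: txy; rewrite /= in_itv/= => txy.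
    by apply/andP; split; lra.
  by rewrite (memNset txy) mulr0; case: ifPn.
rewrite E2 in E.
rewrite /Rintegral -[f y - f x]opprB -[RHS]opprK; congr (- _).
apply: EFin_inj; rewrite EFinB E EFinN fineK//.
apply: integrable_fin_num => //.
apply: integrableS gi => // t /=; rewrite in_itv/= => txy.
by apply/andP; split; lra.
Qed.

End WeakDerivativeFTC.

(** * Sign rigidity of nearly affine functions *)

Section NearAffine.
Context {R : realType}.
Local Notation mu := (@lebesgue_measure R).

Lemma near_one_lb (x : R) : 0 < x -> (x ^+ 2 - 1) ^+ 2 <= (1 / 50) ^+ 2 ->
  49 / 50 <= x <= 51 / 50.
Proof.
move=> x0 H; have : -(1/50) <= x ^+ 2 - 1 <= 1 / 50.
  rewrite -ler_norml -(@ler_pXn2r _ 2)// ?nnegrE// real_normK ?num_real//; lra.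
move=> /andP[H1 H2]; apply/andP; split; rewrite leNgt; apply/negP => H3.
  have : 0 < (49 / 50 - x) * (49 / 50 + x) by rewrite mulr_gt0; lra.
  lra.
have : 0 < (x - 51 / 50) * (51 / 50 + x) by rewrite mulr_gt0; lra.
lra.
Qed.

(* The three nearly extremal values cannot change sign: by near-affinity such a
   change would make the third one overshoot. *)
Lemma same_sign_affine (u1 u2 u3 uz m X Y Z : R) :
  (u1 ^+ 2 - 1) ^+ 2 <= (1 / 50) ^+ 2 -> (u2 ^+ 2 - 1) ^+ 2 <= (1 / 50) ^+ 2 ->
  (u3 ^+ 2 - 1) ^+ 2 <= (1 / 50) ^+ 2 ->
  1 / 5 <= X <= 2 -> 1 / 5 <= Y <= 2 -> `|Z| <= 2 ->
  `|u2 - u1 - m * X| <= 1 / 100 * X ->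
  `|u3 - u2 - m * Y| <= 1 / 100 * Y ->
  `|uz - u1 - m * Z| <= 1 / 100 * `|Z| ->
  0 < u1 -> 0 < uz.
Proof.
move=> h1 h2 h3 hX hY hZ e1 e2 ez u10.
have hu1 := near_one_lb _ u10 h1.
have u20 : 0 < u2.
  rewrite ltNge; apply/negP => u20.
  have u2n : 0 < - u2.
    rewrite oppr_gt0 lt_neqAle u20 andbT; apply/eqP => u2E.
    by move: h2; rewrite u2E; lra.
  have hu2 : 49 / 50 <= - u2 <= 51 / 50.
    by apply: near_one_lb => //; rewrite sqrrN.
  move: e1 e2; rewrite !ler_norml => e1 e2.
  (* A drop of at least 98/50 over a length at most 2, with error 1/100 per unit length, forces this
     slope. One more stretch of length at least 1/5 then takes [u3] below -11/10, too far from
     -1. *)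
  have hm : m <= - (97 / 100).
    rewrite leNgt; apply/negP => hm.
    have : 0 < (m + 97 / 100) * X by rewrite mulr_gt0; lra.
    lra.
  have u3l : u3 <= - (11 / 10).
    have : 0 <= (- (97 / 100) - m) * Y by rewrite mulr_ge0; lra.
    lra.
  have : 49 / 50 <= - u3 <= 51 / 50 by apply: near_one_lb; [lra|rewrite sqrrN].
  lra.
have hu2 := near_one_lb _ u20 h2.
move: e1; rewrite ler_norml => e1.
(* Now [u1] and [u2] differ by at most 1/25 over a length at least 1/5, so the slope is small in
   both directions, and [uz] cannot come down to 0 within distance 2. *)
have hm1 : m <= 3 / 10.
  rewrite leNgt; apply/negP => hm.
  have : 0 < (m - 3 / 10) * X by rewrite mulr_gt0; lra.
  lra.
have hm2 : - (3 / 10) <= m.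
  rewrite leNgt; apply/negP => hm.
  have : 0 < (- (3 / 10) - m) * X by rewrite mulr_gt0; lra.
  lra.
have hmZ : `|m * Z| <= 6 / 10.
  have hm : `|m| <= 3 / 10 by rewrite ler_norml; lra.
  rewrite normrM (le_trans (ler_pM _ _ hm hZ))//; lra.
move: ez hmZ; rewrite !ler_norml; lra.
Qed.

Lemma same_sign_affineN (u1 u2 u3 uz m X Y Z : R) :
  (u1 ^+ 2 - 1) ^+ 2 <= (1 / 50) ^+ 2 -> (u2 ^+ 2 - 1) ^+ 2 <= (1 / 50) ^+ 2 ->
  (u3 ^+ 2 - 1) ^+ 2 <= (1 / 50) ^+ 2 ->
  1 / 5 <= X <= 2 -> 1 / 5 <= Y <= 2 -> `|Z| <= 2 ->
  `|u2 - u1 - m * X| <= 1 / 100 * X ->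
  `|u3 - u2 - m * Y| <= 1 / 100 * Y ->
  `|uz - u1 - m * Z| <= 1 / 100 * `|Z| ->
  u1 < 0 -> uz < 0.
Proof.
move=> h1 h2 h3 hX hY hZ e1 e2 ez u10; rewrite -oppr_gt0.
apply: (@same_sign_affine (- u1) (- u2) (- u3) (- uz) (- m) X Y Z);
  rewrite ?sqrrN ?oppr_gt0//.
- by rewrite (_ : _ - _ = - (u2 - u1 - m * X)) ?normrN//; ring.
- by rewrite (_ : _ - _ = - (u3 - u2 - m * Y)) ?normrN//; ring.
- by rewrite (_ : _ - _ = - (uz - u1 - m * Z)) ?normrN//; ring.
Qed.

End NearAffine.

(** * Constant sign on an interval of small energy *)

Section SmallEnergy.
Context {R : realType}.
Local Notation mu := (@lebesgue_measure R).
Implicit Types (u v w : R -> R).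

Lemma ae_imply (P Q : R -> Prop) : (forall x, P x -> Q x) ->
  {ae mu, forall x, P x} -> {ae mu, forall x, Q x}.
Proof.
move=> PQ [N [mN N0 PN]]; exists N; split => // t /= Ht.
by apply: PN => /= Pt; apply: Ht; exact: PQ.
Qed.

Definition density (e : R) u w (x : R) : R :=
  e^-1 * (u x ^+ 2 - 1) ^+ 2 + e ^+ 3 * `|w x| ^+ 2.

Lemma density_ge0 e u w x : 0 < e -> 0 <= density e u w x.
Proof.
move=> /ltW e0; apply: addr_ge0; apply: mulr_ge0.
- by rewrite invr_ge0.
- exact: sqr_ge0.
- exact: exprn_ge0.
- exact: sqr_ge0.
Qed.

Lemma measurable_density e u w (D : set R) : measurable_fun D u ->
  measurable_fun D w -> measurable_fun D (density e u w).
Proof.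
move=> mu_ mw; apply: measurable_funD; apply: measurable_funM => //.
  by apply: measurable_funX; apply: measurable_funB => //; exact: measurable_funX.
by apply: measurable_funX; exact: measurableT_comp.
Qed.

(** AM-GM: keeping only the second-derivative term, the gap is [(2 * r)^-1] times the square of
    [r / e - e * |w x|]. *)
Lemma le_abs_density (r e : R) u w x : 0 < r -> 0 < e ->
  `|w x| <= r / (2 * e ^+ 2) + (2 * r * e)^-1 * density e u w x.
Proof.
move=> r0 e0.
apply: (@le_trans _ _ (r / (2 * e ^+ 2) + (2 * r * e)^-1 * (e ^+ 3 * `|w x| ^+ 2))).
  set t := `|w x|.
  rewrite -subr_ge0.
  have -> : r / (2 * e ^+ 2) + (2 * r * e)^-1 * (e ^+ 3 * t ^+ 2) - t =
      (2 * r)^-1 * (r / e - e * t) ^+ 2.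
    by field; rewrite !gt_eqF.
  by rewrite mulr_ge0 ?sqr_ge0// invr_ge0 mulr_ge0// ltW.
rewrite lerD2l ler_wpM2l ?invr_ge0 ?mulr_ge0 ?(ltW r0) ?(ltW e0)//.
by rewrite lerDr mulr_ge0 ?invr_ge0 ?sqr_ge0 ?(ltW e0).
Qed.

Lemma lebesgue_measure_itvoo (c d : R) : c < d -> mu `]c, d[ = (d - c)%:E.
Proof. by move=> cd; rewrite lebesgue_measure_itv/= lte_fin cd. Qed.

Lemma lebesgue_measure_itvoc (c d : R) : c < d -> mu `]c, d] = (d - c)%:E.
Proof. by move=> cd; rewrite lebesgue_measure_itv/= lte_fin cd. Qed.

(** [J] stands for two adjacent cells, and [P] for a conull set on which [u] and [v] are recovered
    by integrating [v] and [w]. Pointwise claims are confined to [P], since [u] and [v] may be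
    arbitrary on a null set. *)
Variables (u v w : R -> R) (P : set R) (e c L : R).
Hypotheses (e0 : 0 < e) (eL : e <= L) (Le : L <= 2 * e).
Let J := `]c, (c + L)[%classic.
Hypothesis aeP : {ae mu, forall x, P x}.
Hypothesis vi : mu.-integrable J (EFin \o v).
Hypothesis wi : mu.-integrable J (EFin \o w).
Hypothesis mu_ : measurable_fun J u.
Hypothesis vw : forall x y, J x -> J y -> P x -> P y -> x < y ->
  v y - v x = \int[mu]_(t in `]x, y]) w t.
Hypothesis uv : forall x y, J x -> J y -> P x -> P y -> x < y ->
  u y - u x = \int[mu]_(t in `]x, y]) v t.
(* With r = 1/150 and eta = r^2, the interval carries [int |w| <= 3r/(2e) = 1/(100e)],
   and eta < (1/50)^2 / 5 leaves a point with |u^2 - 1| <= 1/50 in each fifth. *)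
Let eta : R := (1 / 150) ^+ 2.
Hypothesis energy : (\int[mu]_(x in J) (density e u w x)%:E <= eta%:E)%E.

Let L0 : 0 < L. Proof. exact: lt_le_trans e0 eL. Qed.
Let mJ : measurable J. Proof. exact: measurable_itv. Qed.
Let mw : measurable_fun J w.
Proof. by apply/measurable_EFinP; exact: measurable_int wi. Qed.
Let mv : measurable_fun J v.
Proof. by apply/measurable_EFinP; exact: measurable_int vi. Qed.
Let muJ : mu J = L%:E.
Proof. by rewrite /J lebesgue_measure_itvoo ?ltrDl// addrAC subrr add0r. Qed.
Let mf := @measurable_density e u w J mu_ mw.
Let subJ x y : J x -> J y -> `]x, y]%classic `<=` J.
Proof.
rewrite /J /= !in_itv/= => /andP[cx xL] /andP[cy yL] t /=; rewrite in_itv/=.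
by move=> /andP[xt ty]; rewrite in_itv/= (lt_trans cx xt) (le_lt_trans ty yL).
Qed.

Let int_w : (\int[mu]_(x in J) `|w x|%:E <= ((1 / 100) / e)%:E)%E.
Proof.
pose r : R := 1 / 150.
have r0 : 0 < r by rewrite /r divr_gt0.
have k0 : 0 <= (2 * r * e)^-1 by rewrite invr_ge0 !mulr_ge0// ltW.
have k1 : 0 <= r / (2 * e ^+ 2).
  by rewrite divr_ge0 ?mulr_ge0 ?exprn_ge0// ltW.
apply: (@le_trans _ _ (\int[mu]_(x in J)
    ((r / (2 * e ^+ 2))%:E + (2 * r * e)^-1%:E * (density e u w x)%:E))%E).
  apply: ge0_le_integral => //.
  - by apply/measurable_EFinP; exact: measurableT_comp.
  - apply/measurable_EFinP; apply: measurable_funD => //.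
    exact: measurable_funM.
  - by move=> x _; rewrite -EFinM -EFinD lee_fin; exact: le_abs_density.
rewrite ge0_integralD//; last 2 first.
- by move=> x _; rewrite -EFinM lee_fin mulr_ge0// density_ge0.
- by apply/measurable_EFinP; exact: measurable_funM.
rewrite integral_cst// ge0_integralZl_EFin//; last 2 first.
- by move=> x _; rewrite lee_fin density_ge0.
- exact/measurable_EFinP.
rewrite [X in (_ * X + _)%E]muJ.
apply: (@le_trans _ _ ((r / (2 * e ^+ 2))%:E * L%:E + (2 * r * e)^-1%:E * eta%:E)%E).
  by rewrite leeD2l// lee_wpmul2l// lee_fin.
rewrite -!EFinM -EFinD lee_fin.
apply: (@le_trans _ _ (r / (2 * e ^+ 2) * (2 * e) + (2 * r * e)^-1 * eta)).
  by rewrite lerD2r ler_wpM2l.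
rewrite le_eqVlt; apply/orP; left; apply/eqP.
have -> : eta = r ^+ 2 by [].
have -> : (1 / 100 : R) = 3 / 2 * r by rewrite /r; field.
by field; rewrite !gt_eqF.
Qed.

Let osc_v x y : J x -> J y -> P x -> P y -> `|v x - v y| <= (1 / 100) / e.
Proof.
have H s t : J s -> J t -> P s -> P t -> s < t -> `|v t - v s| <= (1 / 100) / e.
  move=> Js Jt Ps Pt st; rewrite vw//.
  have wst : mu.-integrable `]s, t] (EFin \o w).
    by apply: integrableS wi => //; exact: subJ.
  rewrite -lee_fin EFin_normr_Rintegral//.
  apply: le_trans (le_abse_integral _ _ _) _ => //; first exact: measurable_int wst.
  apply: le_trans int_w; apply: ge0_subset_integral => //; last exact: subJ.
  by apply/measurable_EFinP; exact: measurableT_comp.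
move=> Jx Jy Px Py; have [xy|yx|->] := ltgtP x y.
- by rewrite distrC; exact: H.
- exact: H.
- by rewrite subrr normr0 divr_ge0// ltW.
Qed.

(** The left side is the integral of [v t - v z], bounded almost everywhere by the oscillation of
    [v]. As [z] need not lie between [x] and [y], a single slope serves all pairs of points. *)
Let affine_u z x y : J z -> P z -> J x -> J y -> P x -> P y -> x < y ->
  `|u y - u x - v z * (y - x)| <= (1 / 100) / e * (y - x).
Proof.
move=> Jz Pz Jx Jy Px Py xy.
have vxy : mu.-integrable `]x, y] (EFin \o v).
  by apply: integrableS vi => //; exact: subJ.
have muxy : mu `]x, y] = (y - x)%:E by rewrite lebesgue_measure_itvoc.
have zxy : mu.-integrable `]x, y] (EFin \o (fun=> v z)).
  apply: measurable_bounded_integrable => //; first by rewrite [ltLHS]muxy ltry.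
  by exists `|v z|; split => [|s vs t _ /=]; [exact: num_real|exact: ltW].
have -> : v z * (y - x) = \int[mu]_(t in `]x, y]) (v z).
  by rewrite Rintegral_cst// [X in fine X]muxy.
rewrite uv// -RintegralB// -lee_fin EFin_normr_Rintegral//; last first.
  by have := integrableB _ vxy zxy; exact.
apply: le_trans (le_abse_integral _ _ _) _ => //.
  by apply/measurable_EFinP; apply: measurable_funB => //; apply/measurable_EFinP; exact: measurable_int vxy.
rewrite EFinM -[X in (_ <= _ * X)%E]muxy -integral_cst//.
apply: ae_ge0_le_integral => //.
- apply/measurable_EFinP; apply: measurableT_comp => //.
  by apply: measurable_funB => //; apply/measurable_EFinP; exact: measurable_int vxy.
- by move=> t _; rewrite lee_fin divr_ge0// ltW.
- apply: ae_imply aeP => t Pt txy /=; rewrite lee_fin.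
  apply: osc_v => //; exact: subJ txy.
Qed.

(** Otherwise the potential term alone exceeds [(1/50)^2 / e] almost everywhere on a length at least
    [e / 5], giving energy at least [(1/50)^2 / 5], whereas [eta] is [(1/50)^2 / 9]. *)
Let good_point p q : c <= p -> q <= c + L -> L / 5 <= q - p ->
  exists2 x, P x & p < x < q /\ (u x ^+ 2 - 1) ^+ 2 <= (1 / 50) ^+ 2.
Proof.
move=> cp qL pq; apply: contrapT => H.
have pq0 : p < q by rewrite -subr_gt0 (lt_le_trans _ pq)// divr_gt0.
have : ((e^-1 * (1 / 50) ^+ 2)%:E * (q - p)%:E <= eta%:E)%E.
  rewrite -lebesgue_measure_itvoo// -integral_cst//.
  apply: le_trans energy.
  have sub : `]p, q[%classic `<=` J.
    move=> t /=; rewrite /J /= !in_itv/= => /andP[pt tq].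
    by rewrite (le_lt_trans cp pt) (lt_le_trans tq qL).
  apply: (@le_trans _ _ (\int[mu]_(x in `]p, q[) (density e u w x)%:E)%E).
    apply: ae_ge0_le_integral => //.
    - by move=> t _; rewrite lee_fin mulr_ge0 ?sqr_ge0// invr_ge0 ltW.
    - by move=> t _; rewrite lee_fin density_ge0.
    - by apply/measurable_EFinP; exact: measurable_funS mf.
    - apply: ae_imply aeP => t Pt /=; rewrite in_itv/= => tpq; rewrite lee_fin.
      rewrite -[leLHS]addr0 lerD ?mulr_ge0 ?sqr_ge0 ?exprn_ge0 ?(ltW e0)//.
      rewrite ler_wpM2l ?invr_ge0 ?(ltW e0)// leNgt; apply/negP => /ltW Hu.
      by apply: H; exists t.
  apply: ge0_subset_integral => //; first exact/measurable_EFinP.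
  by move=> t _; rewrite lee_fin density_ge0.
rewrite -EFinM lee_fin leNgt => /negP; apply.
apply: (@lt_le_trans _ _ (e^-1 * (1 / 50) ^+ 2 * (e / 5))); last first.
  rewrite ler_wpM2l ?mulr_ge0 ?sqr_ge0 ?invr_ge0 ?(ltW e0)//.
  by rewrite (le_trans _ pq)// ler_wpM2r.
have -> : e^-1 * (1 / 50) ^+ 2 * (e / 5) = (1 / 50) ^+ 2 / 5.
  by field; rewrite gt_eqF.
rewrite /eta.
have -> : (1 / 150 : R) = (1 / 50) / 3 by field.
rewrite expr_div_n ltr_pM2l ?exprn_gt0 ?divr_gt0//.
by rewrite ltf_pV2 ?posrE// ?exprn_gt0//; lra.
Qed.

(** Good points in the first, third and last fifths are at least [L / 5] apart. In the length unit
    [e], near-affinity with slope taken at [x1] carries the sign of [u x1] to all of [J] within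
    [P]. *)
Lemma small_energy_sign :
  (forall x, J x -> P x -> 0 < u x) \/ (forall x, J x -> P x -> u x < 0).
Proof.
have l0 := L0.
have [|||x1 P1 [x1J h1]] := good_point c (c + L / 5); [lra|lra|lra|].
have [|||x2 P2 [x2J h2]] := good_point (c + 2 * L / 5) (c + 3 * L / 5); [lra|lra|lra|].
have [|||x3 P3 [x3J h3]] := good_point (c + 4 * L / 5) (c + L); [lra|lra|lra|].
have J1 : J x1 by rewrite /J /= in_itv/=; lra.
have J2 : J x2 by rewrite /J /= in_itv/=; lra.
have J3 : J x3 by rewrite /J /= in_itv/=; lra.
have X12 : x1 < x2 by lra.
have X23 : x2 < x3 by lra.
have a12 := affine_u _ _ _ J1 P1 J1 J2 P1 P2 X12.
have a23 := affine_u _ _ _ J1 P1 J2 J3 P2 P3 X23.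
(* Passing to the length unit [e] turns the slope into [v x1 * e] and the error rate into the
   absolute constant 1/100. *)
have scale (t s : R) : v x1 * t = v x1 * e * (t / e) /\ 1 / 100 / e * t = 1 / 100 * (t / e).
  by split; field; rewrite gt_eqF.
have az z : J z -> P z ->
    `|u z - u x1 - v x1 * (z - x1)| <= 1 / 100 / e * `|z - x1|.
  move=> Jz Pz; have [xz|zx|->] := ltgtP x1 z.
  - by rewrite (gtr0_norm (x := z - x1)) ?subr_gt0//; exact: affine_u.
  - rewrite (ltr0_norm (x := z - x1)) ?subr_lt0// opprB.
    rewrite (_ : _ - _ = - (u x1 - u z - v x1 * (x1 - z))); last by ring.
    by rewrite normrN; exact: affine_u.
  - by rewrite !subrr mulr0 subrr normr0 mulr0.
have X1 : 1 / 5 <= (x2 - x1) / e <= 2.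
  rewrite ler_pdivlMr// ler_pdivrMr//.
  have := eL; have := Le => ? ?; apply/andP; split; lra.
have X2 : 1 / 5 <= (x3 - x2) / e <= 2.
  rewrite ler_pdivlMr// ler_pdivrMr//.
  have := eL; have := Le => ? ?; apply/andP; split; lra.
have XZ z : J z -> `|(z - x1) / e| <= 2.
  rewrite /J /= in_itv/= => Jz.
  rewrite normrM (gtr0_norm (x := e^-1)) ?invr_gt0// ler_pdivrMr//.
  by rewrite ler_norml; have := Le => ?; apply/andP; split; lra.
have u1n0 : u x1 != 0 by apply/eqP => u10; move: h1; rewrite u10; lra.
have absE z : `|z - x1| / e = `|(z - x1) / e|.
  by rewrite normrM (gtr0_norm (x := e^-1)) ?invr_gt0.
move: a12 a23; rewrite !(scale (_ - _) 0).1 !(scale (_ - _) 0).2 => a12 a23.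
case: (ltgtP 0 (u x1)) u1n0 => // u1 _; [left|right] => z Jz Pz; move: (az z Jz Pz);
  rewrite (scale (_ - _) 0).1 (scale `|_ - _| 0).2 absE => azz.
- exact: (same_sign_affine _ _ _ _ _ _ _ _ h1 h2 h3 X1 X2 (XZ z Jz) a12 a23 azz).
- exact: (same_sign_affineN _ _ _ _ _ _ _ _ h1 h2 h3 X1 X2 (XZ z Jz) a12 a23 azz).
Qed.

End SmallEnergy.

(** * Products of jump functions and counting of cells *)

Section Jumps.
Context {R : realType}.
Local Notation mu := (@lebesgue_measure R).

(** A sign function is encoded as a product of jumps, normalised to 1 far to the right. The list of
    jump points needs no ordering and may have repetitions, so its entries can move freely in a
    limit. *)
Definition jump (t x : R) : R := if x <= t then -1 else 1.

Definition piecewise_sign (T : seq R) (x : R) : R := \prod_(t <- T) jump t x.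

(** Each change of sign at an index from [m] on contributes -1, and the product of the ratios of
    consecutive signs telescopes. *)
Lemma prod_sign_changes (s : nat -> R) (m n : nat) :
  (forall j, s j = 1 \/ s j = -1) -> (m <= n)%N ->
  \prod_(0 <= j < n | s j != s j.+1) (if (m <= j)%N then -1 else 1) = s m * s n.
Proof.
move=> s1; have sq j : s j * s j = 1 by case: (s1 j) => ->; rewrite ?mulrNN mulr1.
elim: n => [|n IH].
  by rewrite leqn0 => /eqP ->; rewrite big_geq// sq.
rewrite leq_eqVlt => /predU1P[->|].
  rewrite sq big_nat_cond big1// => j /andP[/andP[_ jn] _].
  by rewrite ltnNge -ltnS jn.
rewrite ltnS => mn; rewrite big_mkcond big_nat_recr//= -big_mkcond/= IH// mn.
case: ifPn => [|/negPn/eqP <-]; last by rewrite mulr1.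
rewrite -mulrA; case: (s1 n) => ->; case: (s1 n.+1) => -> ; rewrite ?eqxx//= => _; lra.
Qed.

Lemma exists_cell (c : nat -> R) (x : R) (N : nat) : c 0%N < x -> x <= c N ->
  exists2 m, (m < N)%N & c m < x <= c m.+1.
Proof.
move=> c0; elim: N => [|N IH xN]; first by rewrite leNgt c0.
have [xN'|Nx] := leP x (c N); last by exists N => //; rewrite Nx.
by have [m mN cm] := IH xN'; exists m => //; exact: ltnW.
Qed.

(** Markov's inequality for a sum: the two-step increments overlap, so they telescope to two
    differences of values of [G], together at most [2 * M]. *)
Lemma count_large_increments (G : nat -> R) (N K : nat) (M eta : R) : 0 < eta ->
  (forall i, 0 <= G i <= M) -> (forall i, G i <= G i.+1) ->
  2 * M / eta <= K%:R ->
  (size [seq j <- iota 0 N | (eta < G j.+2 - G j)%R] <= K)%N.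
Proof.
move=> eta0 GM Ginc MK; rewrite -(@ler_nat R) (le_trans _ MK)// ler_pdivlMr//.
rewrite size_filter -sum1_count natr_sum mulr_suml.
apply: (@le_trans _ _ (\sum_(0 <= j < N) (G j.+2 - G j))).
  rewrite /index_iota subn0 big_mkcond/=; apply: ler_sum => j _.
  case: ifPn => [/ltW|_]; first by rewrite mul1r.
  by rewrite subr_ge0 (le_trans (Ginc _)).
have -> : \sum_(0 <= j < N) (G j.+2 - G j) = (G N.+1 - G 1%N) + (G N - G 0%N).
  rewrite -(telescope_sumr _ (leq0n N)) -(telescope_sumr (fun j => G j.+1) (leq0n N)).
  by rewrite -big_split/=; apply: eq_bigr => j _; ring.
by have := GM N.+1; have := GM 1%N; have := GM N; have := GM 0%N; lra.
Qed.

Lemma measure_cells (c : nat -> R) (l : R) (r : seq nat) :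
  (forall j, c j.+1 = c j + l) -> 0 < l ->
  measurable (\big[setU/set0]_(j <- r) `]c j, c j.+1]%classic) /\
  (mu (\big[setU/set0]_(j <- r) `]c j, c j.+1]%classic) <= ((size r)%:R * l)%:E)%E.
Proof.
move=> cl l0; elim: r => [|j r [mr IH]]; first by rewrite big_nil measure0 mul0r.
rewrite big_cons; split; first exact: measurableU.
apply: (le_trans (measureU2 _ _ _)) => //.
rewrite /= -natr1 mulrDl mul1r addrC EFinD leeD//.
by rewrite lebesgue_measure_itvoc cl ?ltrDl// addrAC subrr add0r.
Qed.

Lemma ae_exists (P : set R) (p q : R) : {ae mu, forall x, P x} -> p < q ->
  exists2 x, P x & p < x < q.
Proof.
move=> aeP pq; apply: contrapT => H.
have : (mu `]p, q[ <= 0)%E.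
  rewrite -(integral0 mu `]p, q[) -[leLHS]mul1e -integral_cst//.
  apply: ae_ge0_le_integral => //.
  apply: ae_imply aeP => x Px /=; rewrite in_itv/= => xpq.
  by exfalso; apply: H; exists x.
by rewrite lebesgue_measure_itvoo// lee_fin leNgt subr_gt0 pq.
Qed.

End Jumps.

(** * Bounded energy forces boundedly many sign changes *)

Section PiecewiseStructure.
Context {R : realType}.
Local Notation mu := (@lebesgue_measure R).
Implicit Types (u v w : R -> R).

(** On a set of finite measure, [|u| <= 1 + |u|^p] suffices for [p >= 1]. *)
Lemma in_Lp_integrable (a b p : R) u : a < b -> 1 <= p -> in_Lp a b p u ->
  mu.-integrable (Omega a b) (EFin \o u).
Proof.
move=> ab p1 [mu_ uoo]; have mO := measurable_Omega a b.
apply/integrableP; split; first exact/measurable_EFinP.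
have mup : measurable_fun (Omega a b) (fun x => `|u x| `^ p).
  apply: (@measurableT_comp _ _ _ _ _ _ (fun y => y `^ p)); first exact: measurable_powR.
  exact: measurableT_comp.
apply: (@le_lt_trans _ _ (\int[mu]_(x in Omega a b) (1%:E + (`|u x| `^ p)%:E))%E).
  apply: ge0_le_integral => //.
  - by apply/measurable_EFinP; exact: measurableT_comp.
  - by apply/measurable_EFinP; exact: measurable_funD.
  - move=> x _; rewrite -EFinD lee_fin.
    have [u1|u1] := leP `|u x| 1; first by rewrite ler_wpDr// powR_ge0.
    by rewrite ler_wpDl// -[leLHS]powRr1// ler_powR// ltW.
rewrite ge0_integralD//; last exact/measurable_EFinP.
rewrite integral_cst// mul1e [X in (X + _)%E]lebesgue_measure_Omega//.
by rewrite lte_add_pinfty// ltry.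
Qed.

(** The set is that of Lebesgue points of [u] extended by zero, conull by Lebesgue
    differentiation. *)
Lemma weak_derivative_ae (a b : R) u v :
  mu.-integrable (Omega a b) (EFin \o u) ->
  mu.-integrable (Omega a b) (EFin \o v) ->
  (forall phi : R -> R, test_fun a b phi ->
    (\int[mu]_(x in Omega a b) (u x * derive1 phi x)%:E
       = - \int[mu]_(x in Omega a b) (v x * phi x)%:E)%E) ->
  exists2 P : set R, {ae mu, forall x, P x} &
    forall x y, P x -> P y -> a < x -> x < y -> y < b ->
      u y - u x = \int[mu]_(t in `]x, y]) v t.
Proof.
move=> ui vi uv; exists (lebesgue_pt (u \_ (Omega a b))).
  apply: lebesgue_differentiation; apply: integrable_locally => //.
  exact: measurable_Omega.
by move=> x y Px Py ax xy yb; exact: (@weak_derivative_lebesgue_pt _ a b).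
Qed.

Lemma ae_and (P Q : set R) : {ae mu, forall x, P x} -> {ae mu, forall x, Q x} ->
  {ae mu, forall x, P x /\ Q x}.
Proof.
move=> [N [mN N0 PN]] [N' [mN' N'0 PN']]; exists (N `|` N'); split.
- exact: measurableU.
- apply/eqP; rewrite -measure_le0; apply: (@le_trans _ _ (mu N + mu N')%E).
    exact: measureU2.
  by rewrite N0 N'0 adde0.
- move=> x /=; have [Px|nP] := pselect (P x); last by left; exact: PN.
  by have [Qx|nQ] := pselect (Q x); [case|right; exact: PN'].
Qed.

(** At most [K] pairs of adjacent cells carry more energy than the threshold. In every other pair
    both cells have the same constant sign, so sign changes sit only at bad pairs. [T] lists the
    changes and [B] collects the cells whose sign is not controlled. [K] depends on [M] but not on
    [e], which makes the structure uniform along the sequence. *)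
Lemma energy_piecewise_sign (a b e M : R) (K : nat) u v w :
  a < b -> 0 < e -> e <= b - a ->
  mu.-integrable (Omega a b) (EFin \o u) ->
  mu.-integrable (Omega a b) (EFin \o v) ->
  mu.-integrable (Omega a b) (EFin \o w) ->
  (forall phi : R -> R, test_fun a b phi ->
    (\int[mu]_(x in Omega a b) (u x * derive1 phi x)%:E
       = - \int[mu]_(x in Omega a b) (v x * phi x)%:E)%E /\
    (\int[mu]_(x in Omega a b) (v x * derive1 phi x)%:E
       = - \int[mu]_(x in Omega a b) (w x * phi x)%:E)%E) ->
  (\int[mu]_(x in Omega a b) (density e u w x)%:E <= M%:E)%E ->
  2 * M / (1 / 150) ^+ 2 <= K%:R ->
  exists (T : seq R) (B : set R), [/\
    size T = K.+1, (forall t, t \in T -> a <= t <= b),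
    measurable B, (mu B <= (K.+1%:R * e)%:E)%E &
    {ae mu, forall x, Omega a b x -> ~ B x -> 0 < u x * piecewise_sign T x}].
Proof.
move=> ab e0 eba ui vi wi weak EM MK.
have mO := measurable_Omega a b.
have [P1 aeP1 uv] := @weak_derivative_ae a b u v ui vi (fun phi H => (weak phi H).1).
have [P2 aeP2 vw] := @weak_derivative_ae a b v w vi wi (fun phi H => (weak phi H).2).
pose P := P1 `&` P2.
have aeP : {ae mu, forall x, P x} by exact: ae_and.
(* With this count the cell length satisfies [l <= e <= 2 * l], the second part by [e <= b - a]; a
   pair of cells thus has a length between [e] and [2 * e]. *)
pose N := (Num.truncn ((b - a) / e)).+1.
have N0 : 0 < N%:R :> R by rewrite ltr0n.
pose l := (b - a) / N%:R.
have l0 : 0 < l by rewrite divr_gt0// subr_gt0.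
have ba_e0 : 0 <= (b - a) / e by rewrite divr_ge0 ?subr_ge0// ltW.
have /andP[tr1 tr2] := truncn_itv ba_e0.
have le : l <= e by rewrite ler_pdivrMr// mulrC -ler_pdivrMr// ltW.
have e2l : e <= 2 * l.
  rewrite /l mulrA ler_pdivlMr// /N -natr1 mulrDr mulr1.
  have : e * (Num.truncn ((b - a) / e))%:R <= b - a by rewrite mulrC -ler_pdivlMr.
  lra.
pose c (j : nat) := a + j%:R * l.
have c0 : c 0%N = a by rewrite /c mul0r addr0.
have cN : c N = b by rewrite /c mulrC divfK ?gt_eqF// addrCA subrr addr0.
have cS j : c j.+1 = c j + l by rewrite /c -natr1 mulrDl mul1r addrA.
have cle i j : (i <= j)%N -> c i <= c j.
  by move=> ij; rewrite lerD2l ler_wpM2r ?ler_nat// ltW.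
(* Extension by zero gives the cumulative energy [G] a meaning, and the bound [M], also at nodes
   beyond [b]. *)
pose f := density e u w \_ (Omega a b).
have mden : measurable_fun (Omega a b) (density e u w).
  by apply: measurable_density; apply/measurable_EFinP; [exact: measurable_int ui|exact: measurable_int wi].
have f0 x : 0 <= f x by rewrite /f patchE; case: ifPn => // _; exact: density_ge0.
have fM : (\int[mu]_x (f x)%:E <= M%:E)%E.
  apply: le_trans EM; rewrite [leRHS]integral_mkcond.
  rewrite le_eqVlt; apply/orP; left; apply/eqP; apply: eq_integral => x _.
  by rewrite /f !patchE; case: ifPn.
have mf : measurable_fun setT f by exact/(measurable_restrictT _ _).1.
have fi : mu.-integrable setT (EFin \o f).
  apply/integrableP; split; first exact/measurable_EFinP.
  under eq_integral do rewrite /= ger0_norm//.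
  by rewrite (le_lt_trans fM)// ltry.
pose G (j : nat) : R := \int[mu]_(t in `]a, c j]) f t.
have GE i j : (i <= j)%N -> G j - G i = \int[mu]_(t in `]c i, c j]) f t.
  move=> ij; apply: Rintegral_itvB.
  - exact: integrableS fi.
  - by rewrite bnd_simp -c0 cle.
  - by rewrite bnd_simp cle.
have GM i : 0 <= G i <= M.
  rewrite Rintegral_ge0//= -lee_fin /G fineK; last first.
    by apply: integrable_fin_num => //; exact: integrableS fi.
  apply: le_trans fM; apply: ge0_subset_integral => //.
    exact/measurable_EFinP.
  by move=> x _; rewrite lee_fin.
have Ginc i : G i <= G i.+1.
  by rewrite -subr_ge0 GE// Rintegral_ge0.
(* The value -1 is also the default: on a cell belonging to no good pair the choice is immaterial,
   as that cell is put into [B]. *)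
pose s (j : nat) : R := if `[< exists2 x, P x & c j < x < c j.+1 /\ 0 < u x >] then 1 else -1.
have s1 j : s j = 1 \/ s j = -1 by rewrite /s; case: ifPn; [left|right].
have s_pos i : (forall x, P x -> c i < x < c i.+1 -> 0 < u x) -> s i = 1.
  move=> H; rewrite /s ifT//; apply/asboolP.
  have [|x Px xi] := @ae_exists R P (c i) (c i.+1) aeP; first by rewrite cS ltrDl.
  by exists x => //; split => //; exact: H.
have s_neg i : (forall x, P x -> c i < x < c i.+1 -> u x < 0) -> s i = -1.
  move=> H; rewrite /s ifF//; apply/negbTE/asboolPn => -[x Px [xi ux]].
  by have := H x Px xi; rewrite ltNge (ltW ux).
pose bad j := (1 / 150) ^+ 2 < G j.+2 - G j.
(* The open interval spanned by cells [j] and [j.+1] contains their common node, so the sign holds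
   on the half-open cell, right end included. *)
have good j : (j < N.-1)%N -> ~~ bad j -> s j = s j.+1 /\
    forall x, c j < x -> x <= c j.+1 -> P x -> 0 < u x * s j.
  move=> jN; rewrite /bad -leNgt => Gj.
  have jN2 : (j.+2 <= N)%N by move: jN; rewrite /N /= ltnS.
  have c2 : c j + 2 * l = c j.+2 by rewrite !cS; ring.
  have JO : `]c j, (c j + 2 * l)[%classic `<=` Omega a b.
    move=> x /=; rewrite in_itv/= c2 => /andP[cx xc]; apply/andP; split.
      by rewrite (le_lt_trans _ cx)// -c0 cle.
    by rewrite (lt_le_trans xc)// -cN cle.
  have := @small_energy_sign R u v w P e (c j) (2 * l) e0 e2l _ aeP.
  case.
  - by rewrite ler_pM2l.
  - exact: integrableS vi.
  - exact: integrableS wi.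
  - by apply: measurable_funS JO _ => //; apply/measurable_EFinP; exact: measurable_int ui.
  - move=> x y /JO/andP[ax _] /JO/andP[_ yb] [_ Px] [_ Py] xy; exact: vw.
  - move=> x y /JO/andP[ax _] /JO/andP[_ yb] [Px _] [Py _] xy; exact: uv.
  - apply: (@le_trans _ _ (\int[mu]_(x in `]c j, c j.+2]) (f x)%:E)%E); last first.
      rewrite (_ : (\int[mu]_(x in `]c j, c j.+2]) (f x)%:E)%E = (G j.+2 - G j)%:E)//.
      rewrite GE; last by rewrite (leq_trans (leqnSn _)).
      rewrite /Rintegral fineK//; apply: integrable_fin_num => //.
      exact: integrableS fi.
    have -> : (\int[mu]_(x in `]c j, (c j + 2 * l)%R[) (density e u w x)%:E =
        \int[mu]_(x in `]c j, (c j + 2 * l)%R[) (f x)%:E)%E.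
      by apply: eq_integral => x; rewrite inE => /JO xO; rewrite /f patchE mem_set.
    apply: ge0_subset_integral => //.
    + by apply/measurable_EFinP; exact: measurable_funTS.
    + by move=> x _; rewrite lee_fin.
    + by rewrite c2; exact: subset_itv_oo_oc.
  - move=> up; have sj : s j = 1.
      apply: s_pos => x Px /andP[jx xj]; apply: up => //=.
      by rewrite in_itv/= jx c2 (lt_le_trans xj)// cle.
    rewrite sj; split.
      apply/esym/s_pos => x Px /andP[jx xj]; apply: up => //=.
      by rewrite in_itv/= c2 xj andbT (le_lt_trans _ jx)// cle.
    move=> x jx xj Px; rewrite mulr1; apply: up => //=.
    by rewrite in_itv/= jx c2 (le_lt_trans xj)// (cS j.+1) ltrDl.
  - move=> un; have sj : s j = -1.
      apply: s_neg => x Px /andP[jx xj]; apply: un => //=.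
      by rewrite in_itv/= jx c2 (lt_le_trans xj)// cle.
    rewrite sj; split.
      apply/esym/s_neg => x Px /andP[jx xj]; apply: un => //=.
      by rewrite in_itv/= c2 xj andbT (le_lt_trans _ jx)// cle.
    move=> x jx xj Px; rewrite mulrN1 oppr_gt0; apply: un => //=.
    by rewrite in_itv/= jx c2 (le_lt_trans xj)// (cS j.+1) ltrDl.
pose Bd := [seq j <- iota 0 N.-1 | bad j].
have sBd : (size Bd <= K)%N.
  by apply: count_large_increments GM Ginc MK; rewrite exprn_gt0.
(* The nodes between cells of different sign; each belongs to a bad pair, so there are at most
   [K]. *)
pose T' := [seq c j.+1 | j <- [seq j <- iota 0 N.-1 | s j != s j.+1]].
have sT' : (size T' <= K)%N.
  rewrite size_map (leq_trans _ sBd)//; apply: uniq_leq_size.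
    by rewrite filter_uniq// iota_uniq.
  move=> j; rewrite !mem_filter mem_iota /= add0n => /andP[sj jN]; rewrite jN andbT.
  by apply: contraNT sj => /(good _ jN)[->].
(* The first cell of each bad pair, together with the last cell, which begins no pair inside the
   interval. *)
pose B := \big[setU/set0]_(j <- N.-1 :: Bd) `]c j, c j.+1]%classic.
have [mB muB] := @measure_cells R c l (N.-1 :: Bd) cS l0.
(* On [Omega a b], a jump at [a] contributes the sign 1 and a jump at [b] the
   sign -1: the head of the list carries the sign of the last cell. *)
pose t0 := if s N.-1 == 1 then a else b.
(* Padding with [a] gives all lists the same length [K.+1], as a coordinatewise extraction requires,
   without changing the sign inside the interval. *)
exists (t0 :: T' ++ nseq (K - size T') a), B; split => //.
- by rewrite /= size_cat size_nseq subnKC.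
- move=> t; rewrite inE mem_cat => /or3P[/eqP ->|/mapP[j]|].
  + by rewrite /t0; case: ifPn; rewrite lexx ltW.
  +
    rewrite mem_filter mem_iota add0n => /andP[_ /= jN] ->.
    apply/andP; split; first by rewrite -c0 cle.
    by rewrite -cN cle// (leq_trans jN)// leq_pred.
  + by rewrite mem_nseq => /andP[_ /eqP ->]; rewrite lexx ltW.
- apply: (le_trans muB); rewrite lee_fin ler_pM// ?(ltW l0)//.
  by rewrite ler_nat ltnS.
- apply: ae_imply aeP => x Px /= /andP[ax xb] xB.
  have [m mN /andP[cm xm]] : exists2 m, (m < N)%N & c m < x <= c m.+1.
    by apply: exists_cell; rewrite ?c0 ?cN// ltW.
  have xBj j : j \in N.-1 :: Bd -> j != m.
    move=> jB; apply/eqP => jm; apply: xB; rewrite -jm in cm xm.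
    rewrite /B (big_rem j)//=; left => /=; by rewrite in_itv/= cm xm.
  have mN1 : (m < N.-1)%N.
    have := xBj N.-1; rewrite mem_head => /(_ isT); move: mN; rewrite /N /= ltnS => mN.
    by rewrite eq_sym ltn_neqAle mN andbT.
  have mbad : ~~ bad m.
    apply/negP => bm; have := xBj m; rewrite eqxx inE mem_filter bm mem_iota add0n mN1 orbT.
    by move=> /(_ isT).
  (* The changes at or to the right of [x] multiply to [s m * s N.-1], and the head [t0] cancels the
     last sign. *)
  have -> : piecewise_sign (t0 :: T' ++ nseq (K - size T') a) x = s m.
    rewrite /piecewise_sign big_cons big_cat/= big_nseq.
    have -> : jump t0 x = s N.-1.
      rewrite /t0 /jump; case: (s1 N.-1) => ->; rewrite ?eqxx; first by rewrite leNgt ax.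
      have -> : (-1 == 1 :> R) = false by rewrite lt_eqF//; lra.
      by rewrite (ltW xb).
    have -> : jump a x = 1 by rewrite /jump leNgt ax.
    rewrite iter_fix ?mulr1// big_map big_filter.
    have -> : \prod_(j <- iota 0 N.-1 | s j != s j.+1) jump (c j.+1) x =
        \prod_(0 <= j < N.-1 | s j != s j.+1) (if (m <= j)%N then -1 else 1).
      rewrite /index_iota subn0; apply: eq_bigr => j _; rewrite /jump.
      case: (leqP m j) => mj; first by rewrite (le_trans xm)// cle.
      by rewrite leNgt (le_lt_trans _ cm)// cle.
    rewrite (prod_sign_changes s m N.-1 s1 (ltnW mN1)).
    by rewrite mulrCA; case: (s1 N.-1) => ->; rewrite ?mulrNN !mulr1.
  by have [_ ->] := good m mN1 mbad.
Qed.

End PiecewiseStructure.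

(** * Variation, extraction of subsequences and elementary inequalities *)

Section Compactness.
Context {R : realType}.
Local Notation mu := (@lebesgue_measure R).

Lemma jumpE (t x : R) : jump t x = 1 \/ jump t x = -1.
Proof. by rewrite /jump; case: ifPn; [right|left]. Qed.

Lemma piecewise_signE (T : seq R) (x : R) :
  piecewise_sign T x = 1 \/ piecewise_sign T x = -1.
Proof.
rewrite /piecewise_sign; elim: T => [|t T IH]; first by rewrite big_nil; left.
rewrite big_cons; case: (jumpE t x) => ->; first by rewrite mul1r.
by rewrite mulN1r; case: IH => ->; [right|left; rewrite opprK].
Qed.

Lemma norm_piecewise_sign (T : seq R) (x : R) : `|piecewise_sign T x| = 1.
Proof. by case: (piecewise_signE T x) => ->; rewrite ?normrN normr1. Qed.

Lemma measurable_piecewise_sign (T : seq R) (D : set R) :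
  measurable_fun D (piecewise_sign T).
Proof.
apply: measurable_funTS; rewrite /piecewise_sign; elim: T => [|t T IH].
  by under eq_fun do rewrite big_nil; exact: measurable_cst.
under eq_fun do rewrite big_cons; apply: measurable_funM => //.
rewrite (_ : jump t = fun x => 1 - 2 * \1_(`]-oo, t]) x).
  by apply: measurable_funB => //; apply: measurable_funM => //; exact: measurable_indic.
apply/funext => x; rewrite indicE mem_setE in_itv/= /jump; case: ifPn => _ /=; lra.
Qed.

(** A single jump is monotone from -1 to 1, with variation at most 2. All factors have modulus 1, so
    the variation of a product is at most the sum of the variations. *)
Lemma variation_piecewise_sign (T : seq R) (n : nat) (x : nat -> R) :
  (forall i, (i < n)%N -> x i < x i.+1) ->
  \sum_(i < n) `|piecewise_sign T (x i.+1) - piecewise_sign T (x i)| <=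
    2 * (size T)%:R.
Proof.
move=> xinc; rewrite /piecewise_sign; elim: T => [|t T IH].
  by rewrite big1 ?mulr0// => i _; rewrite !big_nil subrr normr0.
have jinc : \sum_(i < n) `|jump t (x i.+1) - jump t (x i)| <= 2.
  have -> : \sum_(i < n) `|jump t (x i.+1) - jump t (x i)| =
      \sum_(0 <= i < n) (jump t (x i.+1) - jump t (x i)).
    rewrite big_mkord; apply: eq_bigr => i _; rewrite ger0_norm// subr_ge0 /jump.
    case: (leP (x i.+1) t) => [xt|_]; first by rewrite (le_trans _ xt)// ltW// xinc.
    by case: ifPn => // _; lra.
  rewrite telescope_sumr//.
  by case: (jumpE t (x n)) => ->; case: (jumpE t (x 0%N)) => ->; lra.
apply: (@le_trans _ _ (\sum_(i < n) `|jump t (x i.+1) - jump t (x i)| +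
    \sum_(i < n) `|\prod_(s <- T) jump s (x i.+1) - \prod_(s <- T) jump s (x i)|)).
  rewrite -big_split/=; apply: ler_sum => i _; rewrite !big_cons.
  set j1 := jump t _; set j0 := jump t _; set p1 := \prod_(_ <- _) _; set p0 := \prod_(_ <- _) _.
  rewrite (_ : _ - _ = (j1 - j0) * p1 + j0 * (p1 - p0)); last by ring.
  rewrite (le_trans (ler_normD _ _))// !normrM.
  have -> : `|p1| = 1 by exact: norm_piecewise_sign.
  have -> : `|j0| = 1 by rewrite /j0; case: (jumpE t (x i)) => ->; rewrite ?normrN normr1.
  by rewrite mulr1 mul1r.
by rewrite /= -[X in _ * X]natr1 mulrDr mulr1 addrC lerD.
Qed.

Lemma BPV_piecewise_sign (a b p : R) (T : seq R) : a < b ->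
  BPV_pm1 a b p (piecewise_sign T).
Proof.
move=> ab; split; [split|split].
- exact: measurable_piecewise_sign.
- under eq_integral do rewrite norm_piecewise_sign powR1.
  rewrite integral_cst; last exact: measurable_Omega.
  by rewrite mul1e [ltLHS](lebesgue_measure_Omega a b ab) ltry.
- by apply: aeW => x _; exact: piecewise_signE.
- apply: (@le_lt_trans _ _ (Var (Omega a b) (piecewise_sign T))).
    by apply: ereal_inf_lbound; exists (piecewise_sign T) => //=; exact: aeW.
  apply: (@le_lt_trans _ _ (2 * (size T)%:R)%:E); last exact: ltry.
  apply: ge_ereal_sup => _ [n [x [_ [xinc ->]]]].
  by rewrite lee_fin variation_piecewise_sign.
Qed.

(** Successive extraction, one coordinate at a time; limits already obtained survive passage to a
    further subsequence. *)
Lemma bolzano_weierstrass_finite (m : nat) (x : nat -> nat -> R) (a b : R) :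
  (forall n i, (i < m)%N -> a <= x n i <= b) ->
  exists (f : nat -> nat) (t : nat -> R), (forall k, (f k < f k.+1)%N) /\
    forall i, (i < m)%N -> (fun k => x (f k) i) @ \oo --> t i.
Proof.
elim: m => [|m IH] xab; first by exists id, (fun=> 0).
have [|f [t [finc ft]]] := IH; first by move=> n i im; apply: xab; exact: ltnW.
have [|g ginc gcvg] := @bolzano_weierstrass R (fun k => x (f k) m).
  exists (`|a| + `|b|); split; first exact: num_real.
  move=> y yab k _ /=; rewrite (le_trans _ (ltW yab))//.
  have /andP[h1 h2] := xab (f k) m (ltnSn m).
  rewrite ler_norml; apply/andP; split.
    rewrite (le_trans _ h1)// opprD; have := ler_norm (- a); rewrite normrN => h.
    by have := normr_ge0 b; lra.
  by rewrite (le_trans h2)// ler_wpDl// ler_norm.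
have ginc' k : (g k < g k.+1)%N by rewrite ltnNge; apply/negP => h; have := ginc k.+1 k; rewrite ltnn leEnat h.
have gid k : (k <= g k)%N.
  by elim: k => // k IHk; exact: leq_ltn_trans (ginc' k).
have finc' i j : (i < j)%N -> (f i < f j)%N.
  by elim: j => // j IHj; rewrite ltnS leq_eqVlt => /predU1P[->|/IHj h]//; exact: ltn_trans (finc j).
exists (f \o g), (fun i => if (i < m)%N then t i else lim ((fun k => x (f (g k)) m) @ \oo)).
split=> [k|i]; first exact: finc'.
rewrite ltnS leq_eqVlt => /predU1P[->|im]; first by rewrite ltnn; exact: gcvg.
rewrite im; have gcv : g @ \oo --> \oo.
  move=> A [N _ NA]; exists N => // k /= Nk; apply: NA => /=; exact: leq_trans (gid k).
exact: cvg_comp gcv (ft i im).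
Qed.

(** If [t <= d < 1] then [t^p <= t <= d]. If [d < t <= 1] then [t^p <= 1 <= (t / d)^4]. If [t > 1]
    then [t^p <= t^4]. *)
Lemma powR_le_interpolation (d t p : R) : 0 < d -> d < 1 -> 0 <= t ->
  1 <= p -> p <= 4 -> t `^ p <= d + d ^- 4 * t ^+ 4.
Proof.
move=> d0 d1 t0 p1 p4.
have d4 : 0 < d ^- 4 by rewrite invr_gt0 exprn_gt0.
have t4 : 0 <= t ^+ 4 by rewrite exprn_ge0.
have [td|dt] := leP t d.
  rewrite ler_wpDr ?mulr_ge0 ?(ltW d4)// (le_trans _ td)//.
  have [->|tn0] := eqVneq t 0; first by rewrite powR0// gt_eqF// (lt_le_trans _ p1).
  rewrite -[leRHS]powRr1// ger_powR// lt_neqAle eq_sym tn0 t0/=; lra.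
rewrite ler_wpDl ?(ltW d0)//.
have [t1|t1] := leP t 1.
  apply: (@le_trans _ _ 1).
    have p0 : 0 <= p by lra.
    by have := @ge0_ler_powR _ p p0 t 1 t0 ler01 t1; rewrite powR1.
  rewrite mulrC ler_pdivlMr ?exprn_gt0// mul1r lerXn2r ?nnegrE ?(ltW d0) ?(ltW dt)//.
apply: (@le_trans _ _ (t ^+ 4)).
  by rewrite -powR_mulrn// ler_powR// ltW.
rewrite ler_peMl// invf_ge1 ?exprn_gt0// exprn_ile1 ?(ltW d0) ?(ltW d1)//.
Qed.

(** Replacing [u] by [-u] reduces to [v = 1], where explicit factorisations exhibit the gaps as
    nonnegative. The additive 128 covers points of opposite signs and will be paid only on a set of
    small measure. *)
Lemma quartic_bound (u v : R) : v = 1 \/ v = -1 ->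
  (u - v) ^+ 4 <= 8 * (u ^+ 2 - 1) ^+ 2 + 128 /\
  (0 < u * v -> (u - v) ^+ 4 <= 8 * (u ^+ 2 - 1) ^+ 2).
Proof.
have H (x : R) : (x - 1) ^+ 4 <= 8 * (x ^+ 2 - 1) ^+ 2 + 128 /\
    (0 < x -> (x - 1) ^+ 4 <= 8 * (x ^+ 2 - 1) ^+ 2).
  have pos : 0 <= x -> (x - 1) ^+ 4 <= 8 * (x ^+ 2 - 1) ^+ 2.
    move=> x0; rewrite -subr_ge0.
    have -> : 8 * (x ^+ 2 - 1) ^+ 2 - (x - 1) ^+ 4 =
      (x - 1) ^+ 2 * (7 * (x + 1) ^+ 2 + 4 * x) by ring.
    apply: mulr_ge0; first exact: sqr_ge0.
    by apply: addr_ge0; apply: mulr_ge0 => //; exact: sqr_ge0.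
  split=> [|/ltW]; last exact: pos.
  have [/pos/le_trans|x0] := leP 0 x; first by apply; rewrite lerDl.
  rewrite -subr_ge0.
  have -> : 8 * (x ^+ 2 - 1) ^+ 2 + 128 - (x - 1) ^+ 4 =
    8 * (x + 1) ^+ 2 * (4 * - x) +
    (x + 3) ^+ 2 * (7 * (x - 3 / 7) ^+ 2 + 96 / 7) by field.
  apply: addr_ge0; apply: mulr_ge0.
  - by apply: mulr_ge0 => //; exact: sqr_ge0.
  - by apply: mulr_ge0 => //; rewrite oppr_ge0 ltW.
  - exact: sqr_ge0.
  - by apply: addr_ge0; [apply: mulr_ge0 => //; exact: sqr_ge0|exact: divr_ge0].
case=> ->; first by rewrite mulr1.
have [H1 H2] := H (- u); move: H1 H2; rewrite sqrrN.
have -> : (- u - 1) ^+ 4 = (u - -1) ^+ 4 by ring.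
by rewrite mulrN1.
Qed.

End Compactness.

(** * From energy and jump points to convergence in L^p *)

Section Convergence.
Context {R : realType}.
Local Notation mu := (@lebesgue_measure R).

(** Two jump functions differ only between their jump points; off the union of these intervals the
    products agree factor by factor. *)
Lemma jump_disagreement (s t : nat -> R) (r : seq nat) :
  exists2 U : set R, measurable U /\ (mu U <= (\sum_(i <- r) `|s i - t i|)%:E)%E &
    forall x, ~ U x ->
      piecewise_sign [seq s i | i <- r] x = piecewise_sign [seq t i | i <- r] x.
Proof.
elim: r => [|i r [U [mU muU] UE]].
  by exists set0 => //; rewrite measure0 big_nil.
have [lo [hi [lohi hl jE]]] : exists lo hi, [/\ lo <= hi, hi - lo = `|s i - t i| &
    forall x, ~ `]lo, hi]%classic x -> jump (s i) x = jump (t i) x].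
  have [st|ts] := leP (s i) (t i).
    exists (s i), (t i); rewrite distrC ger0_norm ?subr_ge0//; split => // x /=.
    rewrite in_itv/= /jump => /negP; rewrite negb_and -leNgt -ltNge => /orP[xs|tx].
      by rewrite xs (le_trans xs).
    by rewrite !leNgt tx (le_lt_trans st).
  exists (t i), (s i); rewrite gtr0_norm ?subr_gt0// (ltW ts); split => // x /=.
  rewrite in_itv/= /jump => /negP; rewrite negb_and -leNgt -ltNge => /orP[xs|tx].
    by rewrite xs (le_trans xs)// ltW.
  by rewrite !leNgt tx (lt_trans ts).
exists (`]lo, hi]%classic `|` U).
  split; first exact: measurableU.
  rewrite big_cons EFinD; apply: (@le_trans _ _ (mu `]lo, hi] + mu U)%E).
    exact: measureU2.
  by rewrite leeD// lebesgue_measure_itv/= lte_fin -hl; case: ifPn => // _; rewrite lee_fin subr_ge0.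
move=> x xU; have [x1 x2] : ~ `]lo, hi]%classic x /\ ~ U x by split => h; apply: xU; [left|right].
rewrite /piecewise_sign !big_map !big_cons (jE _ x1); congr (_ * _).
by have := UE x x2; rewrite /piecewise_sign !big_map.
Qed.

(** Multiplying the density by [8 * e] dominates the potential term of [quartic_bound], and the
    constant 128 is integrated over [B] alone. *)
Lemma quartic_integral_bound (a b e M c : R) (u v w : R -> R) (B : set R) :
  a < b -> 0 < e ->
  measurable_fun (Omega a b) u -> measurable_fun (Omega a b) v ->
  measurable_fun (Omega a b) w ->
  (\int[mu]_(x in Omega a b) (density e u w x)%:E <= M%:E)%E ->
  (forall x, v x = 1 \/ v x = -1) -> measurable B -> (mu B <= c%:E)%E ->
  {ae mu, forall x, Omega a b x -> ~ B x -> 0 < u x * v x} ->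
  (\int[mu]_(x in Omega a b) ((u x - v x) ^+ 4)%:E <= (8 * e * M + 128 * c)%:E)%E.
Proof.
move=> ab e0 mu_ mv mw EM v1 mB muB aeB; have mO := measurable_Omega a b.
have mden := measurable_density e u w _ mu_ mw.
have four0 (x : R) : 0 <= x ^+ 4 by rewrite (exprM x 2 2) sqr_ge0.
have mind : measurable_fun (Omega a b) (\1_B : R -> R) by exact: measurable_indic.
apply: (@le_trans _ _ (\int[mu]_(x in Omega a b)
    ((8 * e)%:E * (density e u w x)%:E + 128%:E * (\1_B x)%:E))%E).
  apply: ae_ge0_le_integral => //.
  - by move=> x _; rewrite lee_fin.
  - by apply/measurable_EFinP; apply: measurable_funX; exact: measurable_funB.
  - move=> x _; rewrite -!EFinM -EFinD lee_fin; apply: addr_ge0; apply: mulr_ge0 => //.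
      by rewrite mulr_ge0// ltW.
    exact: density_ge0.
  - by apply/measurable_EFinP; apply: measurable_funD; exact: measurable_funM.
  - apply: ae_imply aeB => x xB xO; rewrite -!EFinM -EFinD lee_fin.
    have [H1 H2] := quartic_bound (u x) (v x) (v1 x).
    have le_den : 8 * (u x ^+ 2 - 1) ^+ 2 <= 8 * e * density e u w x.
      rewrite -mulrA ler_wpM2l// /density mulrDr mulVKf ?gt_eqF// lerDl.
      apply: mulr_ge0; first exact: ltW.
      by apply: mulr_ge0; [rewrite exprn_ge0// ltW|exact: sqr_ge0].
    rewrite indicE; have [xb|xb] := pselect (B x).
      by rewrite mem_set// mulr1 (le_trans H1)// lerD2r.
    by rewrite memNset// mulr0 addr0 (le_trans (H2 (xB xO xb))).
have den0 x : 0 <= density e u w x by exact: density_ge0.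
have e8 : 0 <= 8 * e by rewrite mulr_ge0// ltW.
rewrite ge0_integralD//; do ?[by apply/measurable_EFinP; exact: measurable_funM|
  by move=> x _; rewrite -EFinM lee_fin mulr_ge0].
rewrite !ge0_integralZl_EFin//; do ?[exact/measurable_EFinP|by move=> x _; rewrite lee_fin].
apply: (@le_trans _ _ ((8 * e)%:E * M%:E + 128%:E * c%:E)%E); last first.
  by rewrite -!EFinM -EFinD.
apply: leeD.
  by rewrite lee_wpmul2l.
rewrite lee_wpmul2l// integral_indic// (le_trans _ muB)// le_measure// ?inE//.
exact: measurableI.
Qed.

Lemma Lp_integral_bound (a b p d r : R) (u v : R -> R) : a < b ->
  0 < d -> d < 1 -> 1 <= p -> p <= 4 ->
  measurable_fun (Omega a b) u -> measurable_fun (Omega a b) v ->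
  (\int[mu]_(x in Omega a b) ((u x - v x) ^+ 4)%:E <= r%:E)%E ->
  (\int[mu]_(x in Omega a b) (`|u x - v x| `^ p)%:E <=
    (d * (b - a) + d ^- 4 * r)%:E)%E.
Proof.
move=> ab d0 d1 p1 p4 mu_ mv ur; have mO := measurable_Omega a b.
have d4 : 0 <= d ^- 4 by rewrite invr_ge0 exprn_ge0// ltW.
have four0 (x : R) : 0 <= x ^+ 4 by rewrite (exprM x 2 2) sqr_ge0.
have m4 : measurable_fun (Omega a b) (fun x => (u x - v x) ^+ 4).
  by apply: measurable_funX; exact: measurable_funB.
apply: (@le_trans _ _ (\int[mu]_(x in Omega a b)
    (d%:E + (d ^- 4)%:E * ((u x - v x) ^+ 4)%:E))%E).
  apply: ge0_le_integral => //.
  - apply/measurable_EFinP; apply: (@measurableT_comp _ _ _ _ _ _ (fun y => y `^ p)).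
      exact: measurable_powR.
    by apply: measurableT_comp => //; exact: measurable_funB.
  - by apply/measurable_EFinP; apply: measurable_funD => //; exact: measurable_funM.
  - move=> x _; rewrite -EFinM -EFinD lee_fin.
    have -> : (u x - v x) ^+ 4 = `|u x - v x| ^+ 4.
      by rewrite !(exprM _ 2 2) real_normK ?num_real.
    exact: powR_le_interpolation.
rewrite ge0_integralD//; do ?[by apply/measurable_EFinP; exact: measurable_funM|
  by move=> x _; rewrite -EFinM lee_fin mulr_ge0|by move=> x _; rewrite lee_fin ltW].
rewrite integral_cst// ge0_integralZl_EFin//; do ?[exact/measurable_EFinP|
  by move=> x _; rewrite lee_fin].
apply: (@le_trans _ _ (d%:E * (b - a)%:E + (d ^- 4)%:E * r%:E)%E); last first.
  by rewrite -!EFinM -EFinD.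
apply: leeD; last by rewrite lee_wpmul2l.
by rewrite [X in (_ * X)%E]lebesgue_measure_Omega.
Qed.

(** The parameter [d] is fixed first so that [d * c] is at most half the tolerance; only then is [n]
    taken large enough for [r n] to absorb [d ^- 4]. *)
Lemma cvg_interpolation (I : nat -> \bar R) (r : nat -> R) (c : R) : 0 <= c ->
  (forall n, 0 <= I n)%E ->
  (forall d n, 0 < d -> d < 1 -> (I n <= (d * c + d ^- 4 * r n)%:E)%E) ->
  r @ \oo --> 0 -> I @ \oo --> 0%E.
Proof.
move=> c0 I0 Ir rcvg.
have If n : (fine (I n))%:E = I n.
  rewrite fineK// ge0_fin_numE// (le_lt_trans (Ir (1 / 2) n _ _)) ?ltry//; lra.
rewrite (_ : I = (fun n => (fine (I n))%:E)); last by apply/funext => n; rewrite If.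
apply: cvg_EFin; first exact: nearW.
apply/cvgrPdist_le => /= eps eps0.
(* Dividing by [c + 1] allows [c = 0], and the cap 1/2 keeps [d] below 1. *)
pose d := Num.min (1 / 2) (eps / (2 * (c + 1))).
have c1 : 0 < 2 * (c + 1) by lra.
have d0 : 0 < d by rewrite lt_min divr_gt0//= divr_gt0.
have d1 : d < 1 by rewrite gt_min; apply/orP; left; lra.
have dc : d * c <= eps / 2.
  apply: (@le_trans _ _ (eps / (2 * (c + 1)) * (c + 1))).
    by rewrite ler_pM ?(ltW d0)// ?ge_min ?lexx ?orbT//; lra.
  by rewrite le_eqVlt; apply/orP; left; apply/eqP; field; lra.
near=> n.
rewrite sub0r normrN ger0_norm ?fine_ge0// -lee_fin If (le_trans (Ir d n d0 d1))//.
rewrite lee_fin; have : r n <= eps / 2 * d ^+ 4.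
  near: n; apply: (cvgr_le 0) => //.
  by rewrite mulr_gt0 ?divr_gt0// exprn_gt0.
rewrite -ler_pdivrMr ?exprn_gt0// => rn.
by rewrite mulrC in rn; lra.
Unshelve. all: by end_near. Qed.

End Convergence.

(** * Extraction of the limit and convergence to it *)

Theorem theorem1p2 (R : realType) (a b p : R) (eps : nat -> R)
  (u : nat -> R -> R) :
  a < b -> 1 <= p -> p <= 4 ->
  (forall n, 0 < eps n) -> eps @ \oo --> 0 ->
  (forall n, in_Lp a b p (u n)) ->
  (exists M : R, forall n, (`|F_eps a b p (eps n) (u n)| <= M%:E)%E) ->
  exists (phi : nat -> nat) (v : R -> R),
    (forall k, (phi k < phi k.+1)%N) /\
    BPV_pm1 a b p v /\
    (fun k => (\int[@lebesgue_measure R]_(x in Omega a b)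
                 ((`|u (phi k) x - v x| `^ p)%:E))%E) @ \oo --> 0%E.
Proof.
move=> ab p1 p4 eps0 epscvg uLp [M FM]; set mu := @lebesgue_measure R.
(* The first [n0] terms are dropped so that every [eps] is at most the length of the interval. *)
have [n0 _ epsle] : \forall n \near \oo, eps n <= b - a.
  by apply: (cvgr_le 0) => //; rewrite subr_gt0.
(* [F_eps] is an infimum; being strictly below [M1], it supplies actual weak derivatives with energy
   below [M1]. *)
pose M1 := M + 1.
pose K := (Num.truncn (2 * M1 / (1 / 150) ^+ 2)).+1.
have MK : 2 * M1 / (1 / 150) ^+ 2 <= K%:R.
  by rewrite ltW// /K truncnS_gt// num_real.
have step n : exists TB : seq R * set R, [/\
    size TB.1 = K.+1 /\ (forall t, t \in TB.1 -> a <= t <= b),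
    measurable TB.2, (mu TB.2 <= (K.+1%:R * eps (n + n0)%N)%:E)%E,
    {ae mu, forall x, Omega a b x -> ~ TB.2 x ->
       0 < u (n + n0)%N x * piecewise_sign TB.1 x} &
    exists2 w, measurable_fun (Omega a b) w &
      (\int[mu]_(x in Omega a b) (density (eps (n + n0)%N) (u (n + n0)%N) w x)%:E
        <= M1%:E)%E].
  set m := (n + n0)%N.
  have FM1 : (F_eps a b p (eps m) (u m) < M1%:E)%E.
    apply: (@le_lt_trans _ _ M%:E); last by rewrite lte_fin ltrDl.
    exact: le_trans (lee_abs _) (FM m).
  have [_ [v [w [[uL [vL [wL weak]]] ->]] Ew]] := ereal_inf_lt FM1.
  have ui := @in_Lp_integrable R a b p (u m) ab p1 uL.
  have vi := @in_Lp_integrable R a b p v ab p1 vL.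
  have wi := @in_Lp_integrable R a b p w ab p1 wL.
  have [|T [B [sT Tab mB muB aeB]]] := @energy_piecewise_sign R a b (eps m) M1 K
    (u m) v w ab (eps0 m) _ ui vi wi weak (ltW Ew) MK.
    by apply: epsle; rewrite /= leq_addl.
  exists (T, B); split => //.
  by exists w; [case: wL|exact: ltW].
have [TB HTB] := choice step.
(* Every list has length [K.+1], so the default [a] is never reached at the indices used. *)
pose x n i := nth a (TB n).1 i.
have xab n i : (i < K.+1)%N -> a <= x n i <= b.
  have [[sT Tab] _ _ _ _] := HTB n.
  by move=> iK; apply: Tab; rewrite mem_nth// sT.
have [f [t [finc ft]]] := @bolzano_weierstrass_finite R K.+1 x a b xab.
have fid k : (k <= f k)%N by elim: k => // k IH; exact: leq_ltn_trans (finc k).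
pose phi k := (f k + n0)%N.
pose v := piecewise_sign [seq t i | i <- iota 0 K.+1].
exists phi, v; split; first by move=> k; rewrite ltn_add2r.
split; first exact: BPV_piecewise_sign.
have epsphi : (fun k => eps (phi k)) @ \oo --> 0.
  apply: (@cvg_comp _ _ _ phi eps); last exact: epscvg.
  move=> A [N _ NA]; exists N => // k /= Nk; apply: NA => /=.
  by rewrite (leq_trans Nk)// (leq_trans (fid k))// leq_addr.
(* Bounds the measure of the exceptional set: the uncontrolled cells, plus the gaps between each
   jump point and its limit. *)
pose beta k := K.+1%:R * eps (phi k) + \sum_(i <- iota 0 K.+1) `|x (f k) i - t i|.
have betacvg : beta @ \oo --> (0 : R).
  rewrite -[X in _ --> X]addr0; apply: cvgD.
    by rewrite -[X in _ --> X](mulr0 K.+1%:R); apply: cvgM => //; exact: cvg_cst.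
  have : forall i, i \in iota 0 K.+1 -> (fun k => `|x (f k) i - t i|) @ \oo --> 0.
    move=> i; rewrite mem_iota => /andP[_ iK].
    rewrite -[X in _ --> X](@normr0 _ R); apply: cvg_norm.
    by rewrite -[X in _ --> X](subrr (t i)); apply: cvgB; [exact: ft|exact: cvg_cst].
  elim: (iota 0 K.+1) => [|i r IH] H.
    by under eq_fun do rewrite big_nil; exact: cvg_cst.
  have Hr : forall j, j \in r -> (fun k => `|x (f k) j - t j|) @ \oo --> 0.
    by move=> j jr; apply: H; rewrite inE jr orbT.
  have C := cvgD (H i (mem_head _ _)) (IH Hr); rewrite addr0 in C.
  rewrite (_ : (fun k => _) = (fun k => `|x (f k) i - t i| +
    \sum_(j <- r) `|x (f k) j - t j|)); first exact: C.
  by apply/funext => k; rewrite big_cons.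
apply: (@cvg_interpolation R _ (fun k => 8 * eps (phi k) * M1 + 128 * beta k) (b - a)).
- by rewrite subr_ge0 ltW.
- by move=> n; apply: integral_ge0 => y _; rewrite lee_fin powR_ge0.
- move=> d k d0 d1.
  have [[sT _] mB muB aeB [w mw Ew]] := HTB (f k).
  have mu_ : measurable_fun (Omega a b) (u (phi k)) by case: (uLp (phi k)).
  have mv : measurable_fun (Omega a b) v by exact: measurable_piecewise_sign.
  have [U [mU muU] UE] := @jump_disagreement R (x (f k)) t (iota 0 K.+1).
  apply: Lp_integral_bound => //.
  apply: (@quartic_integral_bound R a b (eps (phi k)) M1 (beta k) _ _ w ((TB (f k)).2 `|` U)) => //.
  + by move=> y; exact: piecewise_signE.
  + exact: measurableU.
  + apply: (@le_trans _ _ (mu (TB (f k)).2 + mu U)%E); first exact: measureU2.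
    by rewrite /beta EFinD leeD.
  + apply: ae_imply aeB => y yB yO yBU.
    (* Outside the gaps the sign of the k-th list is already that of the limit [v]. *)
    have E : piecewise_sign (TB (f k)).1 y = v y.
      rewrite /v -UE; last by move=> yU; apply: yBU; right.
      by congr piecewise_sign; rewrite -sT; exact/esym/mkseq_nth.
    by rewrite -E; apply: yB => // yTB; apply: yBU; left.
- rewrite -[X in _ --> X]addr0; apply: cvgD.
    rewrite -[X in _ --> X](mul0r M1); apply: cvgM; last exact: cvg_cst.
    by rewrite -[X in _ --> X](mulr0 8); apply: cvgM => //; exact: cvg_cst.
  by rewrite -[X in _ --> X](mulr0 128); apply: cvgM => //; exact: cvg_cst.
Qed.
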